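(* Let $d,n\ge 1$ be integers and let $\mu\in\operatorname{Comp}_d(n)$. The linear map $\Phi_\mu:\operatorname{Mat}_{m_\mu}(\mathcal H^\mu)\to E_\mu Y_{d,n}$ is an isomorphism of $\mathbb C[u^{\pm1},v]$-algebras with inverse map $\Psi_\mu:E_\mu Y_{d,n}\to\operatorname{Mat}_{m_\mu}(\mathcal H^\mu)$. In turn, $$\Phi_n:=\bigoplus_{\mu\in\operatorname{Comp}_d(n)}\Phi_\mu:\ \bigoplus_{\mu\in\operatorname{Comp}_d(n)}\operatorname{Mat}_{m_\mu}(\mathcal H^\mu)\to Y_{d,n}$$ is an isomorphism with inverse map $$\Psi_n:=\bigoplus_{\mu\in\operatorname{Comp}_d(n)}\Psi_\mu:\ Y_{d,n}\to\bigoplus_{\mu\in\operatorname{Comp}_d(n)}\operatorname{Mat}_{m_\mu}(\mathcal H^\mu).$$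
   Context: Let $u,v$ be indeterminates, $A=\mathbb C[u^{\pm1},v]$, and let $\xi_1,\dots,\xi_d$ be the $d$-th roots of unity in $\mathbb C$. Hecke algebra: $\mathcal H_n$ is the associative unital $A$-algebra with generators $T_1,\dots,T_{n-1}$ and relations $T_iT_j=T_jT_i$ ($|i-j|>1$), $T_iT_{i+1}T_i=T_{i+1}T_iT_{i+1}$, $T_i^2=u^2+vT_i$; $\mathcal H_0=\mathcal H_1=A$. Permutations are multiplied as functions, $s_i=(i,i+1)$, $\ell$ is the length function on $\mathfrak S_n$. For $w=s_{i_1}\cdots s_{i_r}$ reduced, $T_w=T_{i_1}\cdots T_{i_r}$ and $\tilde T_w=u^{-\ell(w)}T_w$; $\{\tilde T_w\}_{w\in\mathfrak S_n}$ is an $A$-basis of $\mathcal H_n$. Compositions: $\operatorname{Comp}_d(n)$ is the set of $d$-tuples $\mu=(\mu_1,\dots,\mu_d)$ of non-negative integers with sum $n$. The Young subgroup $\mathfrak S^\mu=\mathfrak S_{\mu_1}\times\dots\times\mathfrak S_{\mu_d}\subset\mathfrak S_n$ has factors acting on consecutive blocks of letters of sizes $\mu_1,\dots,\mu_d$. $\mathcal H^\mu\subset\mathcal H_n$ is the subalgebra generated by the $T_i$ with $s_i\in\mathfrak S^\mu$; it has $A$-basis $\{\tilde T_w\mid w\in\mathfrak S^\mu\}$ and is isomorphic to $\mathcal H_{\mu_1}\otimes\dots\otimes\mathcal H_{\mu_d}$. Set $m_\mu=n!/(\mu_1!\cdots\mu_d!)$. Yokonuma--Hecke algebra: $Y_{d,n}$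 is the associative unital $A$-algebra with generators $g_1,\dots,g_{n-1},t_1,\dots,t_n$ and relations $g_ig_j=g_jg_i$ ($|i-j|>1$), $g_ig_{i+1}g_i=g_{i+1}g_ig_{i+1}$, $t_it_j=t_jt_i$, $g_it_j=t_{s_i(j)}g_i$, $t_j^d=1$, $g_i^2=u^2+v\,e_ig_i$, where $e_i=\frac1d\sum_{s=0}^{d-1}t_i^st_{i+1}^{-s}$. Set $\tilde g_i=u^{-1}g_i$ and, for a reduced expression $w=s_{i_1}\cdots s_{i_r}$, $g_w=g_{i_1}\cdots g_{i_r}$, $\tilde g_w=u^{-\ell(w)}g_w$. Characters and idempotents: let $\mathcal A_n=\langle t_1,\dots,t_n\rangle\subset Y_{d,n}$, isomorphic to the group algebra of $(\mathbb Z/d\mathbb Z)^n$ over $A$, and let $\operatorname{Irr}(\mathcal A_n)$ be the set of complex characters of $(\mathbb Z/d\mathbb Z)^n$ extended to $\mathcal A_n$. For $\chi\in\operatorname{Irr}(\mathcal A_n)$, $E_\chi=\prod_{i=1}^n\bigl(\frac1d\sum_{s=0}^{d-1}\chi(t_i)^st_i^{-s}\bigr)$. $\mathfrak S_n$ acts by $w(\chi)(t_i)=\chi(t_{w^{-1}(i)})$. $\operatorname{Comp}(\chi)$ is the composition $\mu$ with $\mu_a=\#\{j:\chi(t_j)=\xi_a\}$, and $E_\mu=\sum_{\operatorname{Comp}(\chi)=\mu}E_\chi$. The $E_\mu$, $\mu\in\operatorname{Comp}_d(n)$, form a complete set of central orthogonal idempotents, so $Y_{d,n}=\bigoplus_\mu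 E_\mu Y_{d,n}$, and $E_\mu Y_{d,n}$ is an algebra with unit $E_\mu$. Labelling: $\chi_1^\mu$ is the character taking value $\xi_1$ on the first $\mu_1$ of the $t_j$'s, $\xi_2$ on the next $\mu_2$, ..., $\xi_d$ on the last $\mu_d$; its stabilizer is $\mathfrak S^\mu$. $\{\pi_{1,\mu}=1,\pi_{2,\mu},\dots,\pi_{m_\mu,\mu}\}$ is the set of minimal length representatives of the left cosets $\mathfrak S_n/\mathfrak S^\mu$, and $\chi_k^\mu=\pi_{k,\mu}(\chi_1^\mu)$. The set $\{E_{\chi_k^\mu}\tilde g_w\mid 1\le k\le m_\mu,\ w\in\mathfrak S_n\}$ is an $A$-basis of $E_\mu Y_{d,n}$. Maps ($\mathrm M_{i,j}$ denotes the elementary matrix with $1$ in position $(i,j)$): $\Phi_\mu$ is the $A$-linear map with $\Phi_\mu(\tilde T_w\,\mathrm M_{i,j})=E_{\chi_i^\mu}\,\tilde g_{\pi_{i,\mu}w\pi_{j,\mu}^{-1}}\,E_{\chi_j^\mu}$ for $w\in\mathfrak S^\mu$, $1\le i,j\le m_\mu$. $\Psi_\mu$ is the $A$-linear map with $\Psi_\mu(E_{\chi_k^\mu}\tilde g_w)=\tilde T_{\pi_{k,\mu}^{-1}w\pi_{j,\mu}}\,\mathrm M_{k,j}$ for $w\in\mathfrak S_n$, where $j$ is the unique index with $w(\chi_j^\mu)=\chi_k^\mu$ (so that $\pi_{k,\mu}^{-1}w\pi_{j,\mu}\in\mathfrak S^\mu$). *)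

(* Defs.v *)
From HB Require Import structures.
From mathcomp Require Import all_fingroup all_boot all_order all_algebra.
From mathcomp Require Import boolp reals complex.

Set Implicit Arguments.
Unset Strict Implicit.
Unset Printing Implicit Defensive.

Import Order.TTheory GRing.Theory Num.Theory.
Local Open Scope ring_scope.
Local Open Scope quotient_scope.

Section LaurentRing.
Context (C : fieldType).

(* In {poly {poly C}} the inner variable is u and the outer one is v. *)
Definition fracu : {fraction {poly {poly C}}} := tofrac ('X%:P).
Definition fracv : {fraction {poly {poly C}}} := tofrac 'X.

(* Elements of the form p(u, v) / u ^ k. *)
Definition is_laurent : pred {fraction {poly {poly C}}} :=
  fun x => `[< exists (k : nat) (p : {poly {poly C}}), x * fracu ^+ k = tofrac p >].

Lemma is_laurent_subring : subring_closed is_laurent.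
Proof.
split.
- by apply/asboolP; exists 0, 1; rewrite expr0 mulr1 tofrac1.
- move=> x y /asboolP [k [p Hp]] /asboolP [l [q Hq]]; apply/asboolP.
  exists (k + l)%N, (p * ('X%:P) ^+ l - q * ('X%:P) ^+ k).
  rewrite tofracB !tofracM !tofracXn -Hp -Hq mulrBl exprD -!mulrA.
  by rewrite [fracu ^+ k * _]mulrC.
- move=> x y /asboolP [k [p Hp]] /asboolP [l [q Hq]]; apply/asboolP.
  exists (k + l)%N, (p * q).
  by rewrite tofracM -Hp -Hq exprD mulrACA.
Qed.

HB.instance Definition _ :=
  GRing.isSubringClosed.Build {fraction {poly {poly C}}} is_laurent
    is_laurent_subring.

Record laurent : Type := Laurent { lval : {fraction {poly {poly C}}}; _ : is_laurent lval }.

HB.instance Definition _ := [isSub for lval].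
HB.instance Definition _ := [Choice of laurent by <:].
HB.instance Definition _ := [SubChoice_isSubComNzRing of laurent by <:].

Lemma fracu_neq0 : fracu != 0.
Proof. by rewrite tofrac_eq0 polyC_eq0 polyX_eq0. Qed.

Lemma is_laurent_poly p : is_laurent (tofrac p).
Proof. by apply/asboolP; exists 0, p; rewrite expr0 mulr1. Qed.

Lemma is_laurent_uV : is_laurent fracu^-1.
Proof.
by apply/asboolP; exists 1, 1; rewrite expr1 mulVf ?fracu_neq0 // tofrac1.
Qed.

Definition lu : laurent := Laurent (is_laurent_poly 'X%:P).
Definition lv : laurent := Laurent (is_laurent_poly 'X).
Definition luV : laurent := Laurent is_laurent_uV.
Definition lcst (c : C) : laurent := Laurent (is_laurent_poly c%:P%:P).

Lemma luK : lu * luV = 1.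
Proof. by apply: val_inj => /=; rewrite mulfV // fracu_neq0. Qed.

Lemma lcst_zmod_morphism : zmod_morphism lcst.
Proof. by move=> a b; apply: val_inj; rewrite /= !polyCB tofracB. Qed.

Lemma lcst_monoid_morphism : monoid_morphism lcst.
Proof.
by split=> [|a b]; apply: val_inj; rewrite /= ?tofrac1 // !polyCM tofracM.
Qed.

HB.instance Definition _ := GRing.isZmodMorphism.Build C laurent lcst
  lcst_zmod_morphism.
HB.instance Definition _ := GRing.isMonoidMorphism.Build C laurent lcst
  lcst_monoid_morphism.

End LaurentRing.

Inductive term (A X : Type) : Type :=
| Scal of A
| Gen of X
| Add of term A X & term A X
| Mul of term A X & term A X.

Arguments Scal {A X}.
Arguments Gen {A X}.

Declare Scope pterm_scope.
Delimit Scope pterm_scope with PT.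
Bind Scope pterm_scope with term.
Notation "s + t" := (Add s t) : pterm_scope.
Notation "s * t" := (Mul s t) : pterm_scope.
Notation "s ^+ k" := (iter k (Mul s) (Scal 1%R)) : pterm_scope.

HB.instance Definition _ A X := gen_eqMixin (term A X).
HB.instance Definition _ A X := gen_choiceMixin (term A X).

Section Congruence.
Context (A : comNzRingType) (X : Type) (rel : term A X -> term A X -> Prop).
Local Open Scope pterm_scope.

(* The least congruence containing rel whose quotient is an A-algebra. *)
Inductive cong : term A X -> term A X -> Prop :=
| cong_rel s t : rel s t -> cong s t
| cong_refl s : cong s s
| cong_sym s t : cong s t -> cong t s
| cong_trans s t r : cong s t -> cong t r -> cong s r
| cong_add s s' t t' : cong s s' -> cong t t' -> cong (s + t) (s' + t')
| cong_mul s s' t t' : cong s s' -> cong t t' -> cong (s * t) (s' * t')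
| cong_addA s t r : cong (s + (t + r)) (s + t + r)
| cong_addC s t : cong (s + t) (t + s)
| cong_add0 s : cong (Scal 0%R + s) s
| cong_addN s : cong (Scal (- 1)%R * s + s) (Scal 0%R)
| cong_mulA s t r : cong (s * (t * r)) (s * t * r)
| cong_mulDl s t r : cong ((s + t) * r) (s * r + t * r)
| cong_mulDr s t r : cong (s * (t + r)) (s * t + s * r)
| cong_mul1 s : cong (Scal 1%R * s) s
| cong_scalD a b : cong (Scal a + Scal b) (Scal (a + b)%R)
| cong_scalM a b : cong (Scal a * Scal b) (Scal (a * b)%R)
| cong_scalC a s : cong (Scal a * s) (s * Scal a).

End Congruence.

(* The nontriviality field is there only because MathComp algebras are nonzero. *)
Record presentation (A : comNzRingType) := Presentation {
  pgen : Type;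
  prel : term A pgen -> term A pgen -> Prop;
  pres_nontriv : ~ cong prel (Scal 1) (Scal 0)
}.

Section PresentedAlgebra.
Context (A : comNzRingType) (P : presentation A).
Local Notation trm := (term A (pgen P)).

Definition congb : rel trm := fun s t => `[< cong (@prel A P) s t >].

Lemma congb_equiv : equiv_class_of congb.
Proof.
split=> [s|s t|t s r].
- by apply/asboolP; apply: cong_refl.
- by apply/asboolP/asboolP; apply: cong_sym.
- by move=> /asboolP st /asboolP tr; apply/asboolP; apply: cong_trans st tr.
Qed.

Canonical congb_rel := EquivRelPack congb_equiv.

Definition palg : Type := {eq_quot congb_rel}.
HB.instance Definition _ := Choice.on palg.
HB.instance Definition _ := Quotient.on palg.

Definition pclass (t : trm) : palg := \pi_palg t.

Lemma pclassP s t : pclass s = pclass t <-> cong (@prel A P) s t.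
Proof.
split=> [/eqmodP|] H; first exact/asboolP.
by apply/eqmodP; apply/asboolP.
Qed.

Lemma pclass_repr (x : palg) : pclass (repr x) = x.
Proof. exact: reprK. Qed.

Lemma repr_pclass s : cong (@prel A P) (repr (pclass s)) s.
Proof. by apply/pclassP; rewrite pclass_repr. Qed.

Definition padd (x y : palg) := pclass (repr x + repr y)%PT.
Definition pmulr (x y : palg) := pclass (repr x * repr y)%PT.
Definition popp (x : palg) := pclass (Scal (- 1) * repr x)%PT.
Definition pscale (a : A) (x : palg) := pclass (Scal a * repr x)%PT.

Lemma pclassD s t : padd (pclass s) (pclass t) = pclass (s + t)%PT.
Proof. by apply/pclassP; apply: cong_add; apply: repr_pclass. Qed.

Lemma pclassM s t : pmulr (pclass s) (pclass t) = pclass (s * t)%PT.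
Proof. by apply/pclassP; apply: cong_mul; apply: repr_pclass. Qed.

Lemma pclassN s : popp (pclass s) = pclass (Scal (- 1) * s)%PT.
Proof.
by apply/pclassP; apply: cong_mul; [exact: cong_refl | exact: repr_pclass].
Qed.

Lemma pclassZ a s : pscale a (pclass s) = pclass (Scal a * s)%PT.
Proof.
by apply/pclassP; apply: cong_mul; [exact: cong_refl | exact: repr_pclass].
Qed.

Lemma pclassW (Q : palg -> Prop) : (forall s, Q (pclass s)) -> forall x, Q x.
Proof. by move=> HQ x; rewrite -(pclass_repr x). Qed.

Lemma paddA : associative padd.
Proof.
elim/pclassW=> s; elim/pclassW=> t; elim/pclassW=> r.
by rewrite !pclassD; apply/pclassP; apply: cong_addA.
Qed.

Lemma paddC : commutative padd.
Proof.
elim/pclassW=> s; elim/pclassW=> t.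
by rewrite !pclassD; apply/pclassP; apply: cong_addC.
Qed.

Lemma padd0 : left_id (pclass (Scal 0)) padd.
Proof.
by elim/pclassW=> s; rewrite !pclassD; apply/pclassP; apply: cong_add0.
Qed.

Lemma paddN : left_inverse (pclass (Scal 0)) popp padd.
Proof.
by elim/pclassW=> s; rewrite pclassN !pclassD; apply/pclassP; apply: cong_addN.
Qed.

HB.instance Definition _ := GRing.isZmodule.Build palg paddA paddC padd0 paddN.

Lemma pmulA : associative pmulr.
Proof.
elim/pclassW=> s; elim/pclassW=> t; elim/pclassW=> r.
by rewrite !pclassM; apply/pclassP; apply: cong_mulA.
Qed.

Lemma pmul1l : left_id (pclass (Scal 1)) pmulr.
Proof.
by elim/pclassW=> s; rewrite !pclassM; apply/pclassP; apply: cong_mul1.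
Qed.

Lemma pmul1r : right_id (pclass (Scal 1)) pmulr.
Proof.
elim/pclassW=> s; rewrite !pclassM; apply/pclassP.
by apply: cong_trans (cong_mul1 _ s); apply: cong_sym; apply: cong_scalC.
Qed.

Lemma pmulDl : left_distributive pmulr +%R.
Proof.
elim/pclassW=> s; elim/pclassW=> t; elim/pclassW=> r; rewrite -![_ + _]/(padd _ _).
by rewrite !(pclassM, pclassD); apply/pclassP; apply: cong_mulDl.
Qed.

Lemma pmulDr : right_distributive pmulr +%R.
Proof.
elim/pclassW=> s; elim/pclassW=> t; elim/pclassW=> r; rewrite -![_ + _]/(padd _ _).
by rewrite !(pclassM, pclassD); apply/pclassP; apply: cong_mulDr.
Qed.

Lemma pone_neq0 : pclass (Scal 1) != 0.
Proof. by apply/eqP => /pclassP; apply: pres_nontriv. Qed.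

HB.instance Definition _ := GRing.Zmodule_isNzRing.Build palg
  pmulA pmul1l pmul1r pmulDl pmulDr pone_neq0.

Lemma pscaleM a x : pscale a x = pclass (Scal a) * x.
Proof. by elim/pclassW: x => s; rewrite pclassZ; symmetry; apply: pclassM. Qed.

Lemma pscaleA a b x : pscale a (pscale b x) = pscale (a * b) x.
Proof.
rewrite !pscaleM mulrA; congr (_ * _); rewrite -[LHS]/(pmulr _ _) pclassM.
by apply/pclassP; apply: cong_scalM.
Qed.

Lemma pscale1 : left_id 1 pscale.
Proof. by move=> x; rewrite pscaleM; apply: (@mul1r palg x). Qed.

Lemma pscaleDr : right_distributive pscale +%R.
Proof. by move=> a x y; rewrite !pscaleM mulrDr. Qed.

Lemma pscaleDl x : {morph pscale^~ x : a b / a + b}.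
Proof.
move=> a b; rewrite !pscaleM -mulrDl; congr (_ * _).
rewrite -[RHS]/(padd _ _) pclassD.
by apply/pclassP; apply: cong_sym; apply: cong_scalD.
Qed.

HB.instance Definition _ := GRing.Zmodule_isLmodule.Build A palg
  pscaleA pscale1 pscaleDr pscaleDl.

Lemma pscalerAl (a : A) (x y : palg) : a *: (x * y) = (a *: x) * y.
Proof. by rewrite -![a *: _]/(pscale _ _) !pscaleM mulrA. Qed.

HB.instance Definition _ := GRing.Lmodule_isLalgebra.Build A palg pscalerAl.

Lemma pscalerAr (a : A) (x y : palg) : a *: (x * y) = x * (a *: y).
Proof.
rewrite -![a *: _]/(pscale _ _) !pscaleM !mulrA; congr (_ * _).
elim/pclassW: x => s; rewrite -![_ * _]/(pmulr _ _) !pclassM.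
by apply/pclassP; apply: cong_scalC.
Qed.

HB.instance Definition _ := GRing.Lalgebra_isAlgebra.Build A palg pscalerAr.

Definition pelt (x : pgen P) : palg := pclass (Gen x).

End PresentedAlgebra.

Arguments pelt {A} P x.

Fixpoint teval (A : comNzRingType) (X : Type) (B : algType A) (f : X -> B)
    (t : term A X) : B :=
  match t with
  | Scal a => a%:A
  | Gen x => f x
  | Add s t => teval f s + teval f t
  | Mul s t => teval f s * teval f t
  end.

Lemma teval_iter (A : comNzRingType) (X : Type) (B : algType A) (f : X -> B) t k :
  teval f (t ^+ k)%PT = teval f t ^+ k.
Proof. by elim: k => [|k IH] /=; rewrite ?scale1r ?expr0 // exprS IH. Qed.

Lemma teval_sum (A : comNzRingType) (X : Type) (B : algType A) (f : X -> B)
    I (r : seq I) (F : I -> term A X) :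
  teval f (\big[@Add A X/Scal 0]_(i <- r) F i) = \sum_(i <- r) teval f (F i).
Proof.
by elim: r => [|i r IH]; rewrite ?big_nil ?big_cons /= ?scale0r ?IH.
Qed.

Lemma cong_teval (A : comNzRingType) (X : Type) (rel : term A X -> term A X -> Prop)
    (B : algType A) (f : X -> B) :
  (forall s t, rel s t -> teval f s = teval f t) ->
  forall s t, cong rel s t -> teval f s = teval f t.
Proof.
move=> Hrel s t; elim=> {s t} //=; try by [move=> *; congruence].
- by move=> *; rewrite addrA.
- by move=> *; rewrite addrC.
- by move=> *; rewrite scale0r add0r.
- by move=> s; rewrite scaleN1r mulN1r addNr scale0r.
- by move=> *; rewrite mulrA.
- by move=> *; rewrite mulrDl.
- by move=> *; rewrite mulrDr.
- by move=> *; rewrite scale1r mul1r.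
- by move=> *; rewrite scalerDl.
- by move=> a b; rewrite -scalerAl mul1r scalerA.
- by move=> a s; rewrite -scalerAl mul1r -scalerAr mulr1.
Qed.

Lemma pclassE (A : comNzRingType) (P : presentation A) t :
  pclass t = teval (pelt P) t.
Proof.
elim: t => [a|x|s IHs t IHt|s IHs t IHt] //=.
- by rewrite -[a%:A]/(pscale _ _) pscaleM mulr1.
- by rewrite -IHs -IHt -pclassD.
- by rewrite -IHs -IHt -pclassM.
Qed.

Lemma palg_rel (A : comNzRingType) (P : presentation A) s t :
  prel s t -> teval (pelt P) s = teval (pelt P) t.
Proof. by move=> st; rewrite -!pclassE; apply/pclassP/cong_rel. Qed.

Lemma palg_universal (A : comNzRingType) (P : presentation A) (B : algType A)
    (f : pgen P -> B) :
  (forall s t, prel s t -> teval f s = teval f t) ->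
  exists g : palg P -> B, [/\ linear g, monoid_morphism g,
    forall x, g (pelt P x) = f x &
    forall h : palg P -> B, linear h -> monoid_morphism h ->
      (forall x, h (pelt P x) = f x) -> h =1 g].
Proof.
move=> Hf; pose g (x : palg P) := teval f (repr x).
have gE t : g (pclass t) = teval f t.
  exact: (cong_teval Hf (repr_pclass t)).
have gM x y : g (x * y) = g x * g y.
  elim/pclassW: x => s; elim/pclassW: y => t.
  by rewrite -[pclass s * pclass t]/(pmulr _ _) pclassM !gE.
have g1 : g 1 = 1 by rewrite (gE (Scal 1)) /= scale1r.
exists g; split=> //.
- move=> a x y; elim/pclassW: x => s; elim/pclassW: y => t.
  rewrite -[a *: pclass s]/(pscale _ _) pclassZ -[pclass _ + pclass _]/(padd _ _).
  rewrite pclassD !gE /=.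
  by rewrite -scalerAl mul1r.
- by move=> x; rewrite gE.
- move=> h hl [h1 hM] hx; elim/pclassW=> t; rewrite gE pclassE.
  have hD x y : h (x + y) = h x + h y by rewrite -[x]scale1r hl !scale1r.
  have h0 : h 0 = 0 by apply: (addrI (h 0)); rewrite -hD !addr0.
  have hZ a x : h (a *: x) = a *: h x by rewrite -[a *: x]addr0 hl h0 addr0.
  elim: t => [a|x|s IHs t IHt|s IHs t IHt] //=.
  + by rewrite hZ h1.
  + by rewrite hD IHs IHt.
  + by rewrite hM IHs IHt.
Qed.

(* Permutations are multiplied as functions, whereas MathComp's product of
   permutations applies its left factor first. *)
Definition pcomp n (w x : 'S_n) : 'S_n := (x * w)%g.

Lemma pcompE n (w x : 'S_n) i : pcomp w x i = w (x i).
Proof. exact: permM. Qed.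

Definition lo n (i : 'I_n.-1) : 'I_n := widen_ord (leq_pred n) i.

Lemma hi_subproof n (i : 'I_n.-1) : (i.+1 < n)%N.
Proof. by rewrite -ltn_predRL. Qed.

Definition hi n (i : 'I_n.-1) : 'I_n := Ordinal (hi_subproof i).

(* Indices are 0-based: [simple i] exchanges the letters i and i + 1 of 'I_n. *)
Definition simple n (i : 'I_n.-1) : 'S_n := tperm (lo i) (hi i).

Lemma simpleK n (i : 'I_n.-1) : involutive (simple i).
Proof. by move=> j; rewrite /simple tpermK. Qed.

Definition word_perm n (s : seq 'I_n.-1) : 'S_n :=
  foldr (fun i w => pcomp (simple i) w) 1%g s.

Lemma word_perm_cat n (s t : seq 'I_n.-1) :
  word_perm (s ++ t) = pcomp (word_perm s) (word_perm t).
Proof.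
elim: s => [|i s IH] /=; first by rewrite /pcomp mulg1.
by rewrite IH /pcomp mulgA.
Qed.

Lemma tperm_word n (k : nat) (x y : 'I_n) :
  (y = x + k :> nat)%N -> exists s, word_perm s = tperm x y.
Proof.
elim: k y => [|k IH] y Hy.
  by exists [::]; rewrite (_ : y = x) ?tperm1 //; apply: val_inj; rewrite /= Hy addn0.
have Hk : (x + k < n)%N by rewrite ltnW // -addnS -Hy.
have Hk1 : (x + k < n.-1)%N by rewrite ltn_predRL -addnS -Hy.
pose i := Ordinal Hk1; pose z := Ordinal Hk.
have zE : lo i = z by apply: val_inj.
have yE : hi i = y by apply: val_inj; rewrite /= Hy addnS.
have [k0|k0] := posnP k.
  exists [:: i]; rewrite /= /pcomp mul1g /simple zE yE.
  by congr (tperm _ _); apply: val_inj; rewrite /= k0 addn0.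
have [s Hs] := IH z (erefl _).
exists (i :: s ++ [:: i]); rewrite /= word_perm_cat Hs /= /pcomp mul1g.
have xz : z != x by rewrite -val_eqE /= -{2}[val x]addn0 eqn_add2l -lt0n.
have xy : y != x by rewrite -val_eqE /= Hy -{2}[val x]addn0 eqn_add2l.
rewrite -{1}[simple i]invgK tpermV -mulgA -/(conjg _ _) tpermJ.
by rewrite /simple zE yE tpermL tpermD.
Qed.

Lemma word_perm_surj n (w : 'S_n) : exists s, word_perm s = w.
Proof.
have [ts -> _] := prod_tpermP w.
elim: ts => [|[x y] ts [s Hs]]; first by exists [::]; rewrite big_nil.
rewrite big_cons /= -Hs.
have [r Hr] : exists r, word_perm r = tperm x y.
  wlog le_xy : x y / (x <= y)%N.
    by move=> H; case/orP: (leq_total x y) => le; [|rewrite tpermC]; apply: H.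
  by apply: (@tperm_word n (y - x)); rewrite subnKC.
by exists (s ++ r); rewrite word_perm_cat Hr.
Qed.

Lemma has_word_ex n (w : 'S_n) :
  exists k, [exists s : k.-tuple 'I_n.-1, word_perm s == w].
Proof.
have [s Hs] := word_perm_surj w.
by exists (size s); apply/existsP; exists (in_tuple s); rewrite Hs.
Qed.

Definition ell n (w : 'S_n) : nat := ex_minn (has_word_ex w).

Lemma has_word_ell n (w : 'S_n) :
  exists s : (ell w).-tuple 'I_n.-1, word_perm s == w.
Proof. by rewrite /ell; case: ex_minnP => m /existsP. Qed.

(* A chosen reduced expression; by Matsumoto's theorem T_w and g_w below do not
   depend on the choice. *)
Definition redword n (w : 'S_n) : seq 'I_n.-1 := xchoose (has_word_ell w).

Lemma redwordK n (w : 'S_n) : word_perm (redword w) = w.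
Proof. exact/eqP/(xchooseP (has_word_ell w)). Qed.

Lemma size_redword n (w : 'S_n) : size (redword w) = ell w.
Proof. exact: size_tuple. Qed.

Lemma ell_min n (s : seq 'I_n.-1) : (ell (word_perm s) <= size s)%N.
Proof.
rewrite /ell; case: ex_minnP => m _; apply.
by apply/existsP; exists (in_tuple s).
Qed.

Definition Comp (d n : nat) : Type :=
  {mu : {ffun 'I_d -> 'I_n.+1} | \sum_a (mu a : nat) == n}.
HB.instance Definition _ d n := Finite.on (Comp d n).

Definition part d n (mu : Comp d n) (a : 'I_d) : nat := val mu a.
Coercion part : Comp >-> Funclass.

Definition multinom d n (mu : Comp d n) : nat := (n`! %/ \prod_a (mu a)`!)%N.

Definition block d n (mu : Comp d n) (a : 'I_d) : {set 'I_n} :=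
  [set j : 'I_n | (\sum_(b < d | b < a) mu b <= j < \sum_(b < d | b <= a) mu b)%N].

Definition Young d n (mu : Comp d n) : {set 'S_n} :=
  [set w : 'S_n | [forall a, w @: block mu a == block mu a]].

(* A character chi of (Z/d)^n is determined by the d-th roots of unity chi(t_j);
   it is encoded by the function sending j to the index a with chi(t_j) = xi_a. *)
Definition tchar d n : Type := {ffun 'I_n -> 'I_d}.
HB.instance Definition _ d n := Finite.on (tchar d n).

Definition char_act d n (w : 'S_n) (chi : tchar d n) : tchar d n :=
  [ffun i => chi ((w^-1)%g i)].

Definition has_comp d n (mu : Comp d n) : pred (tchar d n) :=
  fun chi => [forall a, #|[set j | chi j == a]| == mu a].

Lemma has_comp_act d n (mu : Comp d n) w chi :
  has_comp mu (char_act w chi) = has_comp mu chi.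
Proof.
apply: eq_forallb => a; congr (_ == _).
rewrite -[RHS](card_imset _ (@perm_inj _ w)); apply: eq_card => j.
rewrite !inE ffunE; apply/idP/imsetP => [H|[k]].
  by exists ((w^-1)%g j); rewrite ?inE // permKV.
by rewrite inE => H ->; rewrite permK.
Qed.

Lemma block_ex d n (mu : Comp d n) (j : 'I_n) : exists a, j \in block mu a.
Proof.
have muS : (\sum_a mu a)%N = n by apply/eqP; exact: (valP mu).
have jn : (j < \sum_a mu a)%N by rewrite muS ltn_ord.
pose P (a : 'I_d) := (j < \sum_(b < d | b <= a) mu b)%N.
have dgt0 : (0 < d)%N.
  by case: d mu jn {muS P} => [|//] mu; rewrite big_ord0.
have amaxP : (d.-1 < d)%N by rewrite prednK.
have Pmax : P (Ordinal amaxP).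
  rewrite /P /= (eq_bigl predT) // => b.
  by rewrite -ltnS prednK ?ltn_ord.
case: (@arg_minnP _ (Ordinal amaxP) P val Pmax) => a Pa amin.
exists a; rewrite inE; apply/andP; split=> //.
have [a00|agt0] := posnP a; first by rewrite big1 // => b; rewrite a00.
have a1P : (a.-1 < d)%N by rewrite (leq_ltn_trans (leq_pred a)).
rewrite leqNgt; apply/negP => H.
have /amin /= : P (Ordinal a1P).
  rewrite /P /=; move: H; congr (_ < _)%N; apply: eq_bigl => b.
  by rewrite -[in LHS](prednK agt0) ltnS.
by rewrite leqNgt prednK // leqnn.
Qed.

(* The blocks partition the letters, so the choice is forced. *)
Definition chi1 d n (mu : Comp d n) : tchar d n :=
  [ffun j => xchoose (block_ex mu j)].

Definition minimal_rep d n (mu : Comp d n) (w : 'S_n) : Prop :=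
  forall x, x \in Young mu -> (ell w <= ell (pcomp w x))%N.

Record labelling d n (mu : Comp d n) (p : 'I_(multinom mu) -> 'S_n) : Prop :=
  Labelling {
    lab_inj : injective p;
    lab_image : forall w, (exists k, p k = w) <-> minimal_rep mu w;
    lab_first : forall k, val k = 0%N -> p k = 1%g
  }.

Lemma companion_quad (A : comNzRingType) (a b : A) :
  exists M : 'M[A]_2, M * M = a%:A + b%:A * M.
Proof.
exists (\matrix_(i, j) if i == 0 then (if j == 0 then 0 else a)
                        else (if j == 0 then 1 else b)).
rewrite -scalerAl mul1r; apply/matrixP => i j.
rewrite !mxE !big_ord_recl big_ord0 !mxE addr0.
by case: i => -[|[|//]] ?; case: j => -[|[|//]] ? /=;
  rewrite !(mulr0, mulr1, mul0r, mul1r, addr0, add0r) // mulrC.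
Qed.

Section Hecke.
Context (C : numFieldType).
Local Notation A := (laurent C).
Local Notation u := (lu C).
Local Notation v := (lv C).
Local Notation uV := (luV C).

Section HeckeRel.
Local Open Scope pterm_scope.

Inductive hecke_rel n : term A 'I_n.-1 -> term A 'I_n.-1 -> Prop :=
| hecke_comm (i j : 'I_n.-1) : (i.+1 < j)%N || (j.+1 < i)%N ->
    hecke_rel (Gen i * Gen j) (Gen j * Gen i)
| hecke_braid (i j : 'I_n.-1) : nat_of_ord j = i.+1 ->
    hecke_rel (Gen i * Gen j * Gen i) (Gen j * Gen i * Gen j)
| hecke_quad (i : 'I_n.-1) :
    hecke_rel (Gen i ^+ 2) (Scal (u ^+ 2)%R + Scal v * Gen i).

End HeckeRel.

Lemma hecke_nontriv n : ~ cong (@hecke_rel n) (Scal 1) (Scal 0).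
Proof.
have [M HM] := companion_quad (u ^+ 2) v.
move=> /(@cong_teval _ _ _ _ (fun _ => M)) H.
have /eqP : (1%:A : 'M[A]_2) = 0%:A.
  apply: H => s t; case=> [i j _|i j _|i] //=.
  by rewrite scale1r mulr1 HM.
by rewrite scale1r scale0r oner_eq0.
Qed.

Definition hecke_pres n : presentation A := Presentation (@hecke_nontriv n).

Definition hecke n : Type := palg (hecke_pres n).
HB.instance Definition _ n := GRing.Algebra.on (hecke n).

Definition genT n (i : 'I_n.-1) : hecke n := pelt (hecke_pres n) i.

Definition Tw n (w : 'S_n) : hecke n := \prod_(i <- redword w) genT i.
Definition tildeT n (w : 'S_n) : hecke n := uV ^+ ell w *: Tw w.

End Hecke.

Inductive subalg (A : comNzRingType) (B : algType A) (S : B -> Prop) : B -> Prop :=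
| subalg_gen x : S x -> subalg S x
| subalg_scal a : subalg S a%:A
| subalg_add x y : subalg S x -> subalg S y -> subalg S (x + y)
| subalg_mul x y : subalg S x -> subalg S y -> subalg S (x * y).

Section YoungHecke.
Context (C : numFieldType) (d n : nat) (mu : Comp d n).
Local Notation A := (laurent C).

Definition in_Hmu : pred (hecke C n) := fun x =>
  `[< subalg (fun y => exists2 i, simple i \in Young mu & y = genT C i) x >].

Lemma in_Hmu_subalg : subalg_closed in_Hmu.
Proof.
split=> [|a x y /asboolP xH /asboolP yH|x y /asboolP xH /asboolP yH].
- by apply/asboolP; rewrite -[1]scale1r; apply: subalg_scal.
- apply/asboolP; apply: subalg_add => //.
  by rewrite -[x]mul1r scalerAl; apply: subalg_mul => //; apply: subalg_scal.
- by apply/asboolP; apply: subalg_mul.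
Qed.

HB.instance Definition _ :=
  GRing.isSubalgClosed.Build A (hecke C n) in_Hmu in_Hmu_subalg.

Record Hmu : Type := HmuSub { hval : hecke C n; _ : in_Hmu hval }.

HB.instance Definition _ := [isSub for hval].
HB.instance Definition _ := [Choice of Hmu by <:].
HB.instance Definition _ := [SubChoice_isSubAlgebra of Hmu by <:].

(* 'M[Hmu]_m carries no A-module structure in MathComp, only an Hmu-module one. *)
Definition MatH : Type := 'M[Hmu]_(multinom mu).

HB.instance Definition _ := GRing.PzRing.copy MatH 'M[Hmu]_(multinom mu).

Definition scaleMat (a : A) (M : MatH) : MatH := map_mx ( *:%R a ) M.

Lemma scaleMatA a b M : scaleMat a (scaleMat b M) = scaleMat (a * b) M.
Proof. by apply/matrixP => i j; rewrite !mxE scalerA. Qed.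

Lemma scaleMat1 : left_id 1 scaleMat.
Proof. by move=> M; apply/matrixP => i j; rewrite !mxE scale1r. Qed.

Lemma scaleMatDr : right_distributive scaleMat +%R.
Proof. by move=> a M N; apply/matrixP => i j; rewrite !mxE scalerDr. Qed.

Lemma scaleMatDl M : {morph scaleMat^~ M : a b / a + b}.
Proof. by move=> a b; apply/matrixP => i j; rewrite !mxE scalerDl. Qed.

HB.instance Definition _ := GRing.Zmodule_isLmodule.Build A MatH
  scaleMatA scaleMat1 scaleMatDr scaleMatDl.

(* M = x M_{i,j}, stated over the whole Hecke algebra: x is an element of it that
   happens to lie in Hmu. *)
Definition is_elem (M : MatH) (x : hecke C n) (i j : 'I_(multinom mu)) : Prop :=
  map_mx hval M = x *: delta_mx i j.

End YoungHecke.

Section DirectSum.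
Context (C : numFieldType) (d n : nat).
Local Notation A := (laurent C).

(* The index set is finite, so the direct sum is the full product. *)
Definition DirSum : Type := {dffun forall mu : Comp d n, MatH C mu}.
HB.instance Definition _ := Choice.on DirSum.

Implicit Types x y z : DirSum.

Definition dzero : DirSum := [ffun mu => 0 : MatH C mu].
Definition dunit : DirSum := [ffun mu => 1 : MatH C mu].
Definition dopp x : DirSum := [ffun mu => - x mu].
Definition dadd x y : DirSum := [ffun mu => x mu + y mu].
Definition dmul x y : DirSum := [ffun mu => x mu * y mu].
Definition dscale (a : A) x : DirSum := [ffun mu => a *: x mu].

Lemma daddA : associative dadd.
Proof. by move=> x y z; apply/ffunP => mu; rewrite !ffunE addrA. Qed.
Lemma daddC : commutative dadd.
Proof. by move=> x y; apply/ffunP => mu; rewrite !ffunE addrC. Qed.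
Lemma dadd0 : left_id dzero dadd.
Proof. by move=> x; apply/ffunP => mu; rewrite !ffunE add0r. Qed.
Lemma daddN : left_inverse dzero dopp dadd.
Proof. by move=> x; apply/ffunP => mu; rewrite !ffunE addNr. Qed.
HB.instance Definition _ := GRing.isZmodule.Build DirSum daddA daddC dadd0 daddN.

Lemma dmulA : associative dmul.
Proof. by move=> x y z; apply/ffunP => mu; rewrite !ffunE mulrA. Qed.
Lemma dmul1r : left_id dunit dmul.
Proof. by move=> x; apply/ffunP => mu; rewrite !ffunE mul1r. Qed.
Lemma dmulr1 : right_id dunit dmul.
Proof. by move=> x; apply/ffunP => mu; rewrite !ffunE mulr1. Qed.
Lemma dmulDl : left_distributive dmul dadd.
Proof. by move=> x y z; apply/ffunP => mu; rewrite !ffunE mulrDl. Qed.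
Lemma dmulDr : right_distributive dmul dadd.
Proof. by move=> x y z; apply/ffunP => mu; rewrite !ffunE mulrDr. Qed.
HB.instance Definition _ := GRing.Zmodule_isPzRing.Build DirSum
  dmulA dmul1r dmulr1 dmulDl dmulDr.

Lemma dscaleA a b x : dscale a (dscale b x) = dscale (a * b) x.
Proof. by apply/ffunP => mu; rewrite !ffunE scalerA. Qed.
Lemma dscale1 : left_id 1 dscale.
Proof. by move=> x; apply/ffunP => mu; rewrite !ffunE scale1r. Qed.
Lemma dscaleDr : right_distributive dscale dadd.
Proof. by move=> a x y; apply/ffunP => mu; rewrite !ffunE scalerDr. Qed.
Lemma dscaleDl x : {morph dscale^~ x : a b / a + b >-> dadd a b}.
Proof. by move=> a b; apply/ffunP => mu; rewrite !ffunE scalerDl. Qed.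
HB.instance Definition _ := GRing.Zmodule_isLmodule.Build A DirSum
  dscaleA dscale1 dscaleDr dscaleDl.

End DirectSum.

Record unity_roots (C : fieldType) (d : nat) : Type := UnityRoots {
  uroot :> 'I_d -> C;
  uroot_inj : injective uroot;
  urootX : forall a, uroot a ^+ d = 1
}.

Lemma shift_sum (A : comNzRingType) (B : algType A) (t : B) (z : A) d :
  z ^+ d = 1 -> t ^+ d = 1 ->
  t * (\sum_(s < d) z ^+ s *: t ^+ (d - s)) = z *: \sum_(s < d) z ^+ s *: t ^+ (d - s).
Proof.
case: d => [|m] zd td; first by rewrite !big_ord0 mulr0 scaler0.
rewrite mulr_sumr scaler_sumr big_ord_recl [in RHS]big_ord_recr /= addrC.
congr (_ + _).
  by rewrite scalerA -exprS zd expr0 !scale1r subn0 td mulr1 subSn // subnn.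
apply: eq_bigr => s _; rewrite -scalerAr scalerA -exprS -exprS; congr (_ *: _).
by rewrite /bump leq0n add1n subSS subSn // ltnW.
Qed.

Lemma root_sum (C : numFieldType) d (xi : unity_roots C d) a b :
  \sum_(s < d) xi b ^+ s * xi a ^+ (d - s) = if b == a then d%:R else 0.
Proof.
have xa0 : xi a != 0.
  apply/eqP => x0; have := urootX xi a.
  case: d xi a b x0 => [|m] xi' a b x0; first by case: a x0.
  by rewrite x0 exprS mul0r => /esym/eqP; rewrite oner_eq0.
have E (s : 'I_d) : xi b ^+ s * xi a ^+ (d - s) = (xi b / xi a) ^+ s.
  rewrite expr_div_n; congr (_ * _).
  apply: (mulIf (expf_neq0 s xa0)); rewrite -exprD subnK ?urootX ?mulVf //.
    by rewrite expf_neq0.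
  exact: ltnW.
rewrite (eq_bigr _ (fun s _ => E s)); case: eqP => [->|ba].
  rewrite mulfV // (eq_bigr (fun=> 1)) => [|s _]; last by rewrite expr1n.
  by rewrite sumr_const card_ord.
apply: (mulfI (x := xi b / xi a - 1)).
  rewrite subr_eq0; apply/eqP => H; apply: ba; apply: (uroot_inj (u := xi)).
  by rewrite -[LHS](mulfVK xa0) H mul1r.
by rewrite -subrX1 expr_div_n !urootX mulr0 invr1 mulr1 subrr.
Qed.

Inductive ygen (n : nat) : Type :=
| gen_g of 'I_n.-1
| gen_t of 'I_n.

Section Yokonuma.
Context (C : numFieldType) (d : nat).
Local Notation A := (laurent C).
Local Notation u := (lu C).
Local Notation v := (lv C).
Local Notation uV := (luV C).

Section YokRel.
Context (n : nat).
Local Open Scope pterm_scope.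

Local Notation g i := (Gen (gen_g i)).
Local Notation t j := (Gen (gen_t j)).

(* As t_j ^ d = 1, the inverse power t_j ^ (- s) is written t_j ^ (d - s). *)
Definition term_e (i : 'I_n.-1) : term A (ygen n) :=
  Scal (lcst (d%:R^-1)%R) *
  \big[@Add _ _/Scal 0%R]_(s < d) (t (lo i) ^+ s * t (hi i) ^+ (d - s)).

Inductive yok_rel : term A (ygen n) -> term A (ygen n) -> Prop :=
| yok_comm (i j : 'I_n.-1) : (i.+1 < j)%N || (j.+1 < i)%N ->
    yok_rel (g i * g j) (g j * g i)
| yok_braid (i j : 'I_n.-1) : nat_of_ord j = i.+1 ->
    yok_rel (g i * g j * g i) (g j * g i * g j)
| yok_tt (i j : 'I_n) : yok_rel (t i * t j) (t j * t i)
| yok_gt (i : 'I_n.-1) (j : 'I_n) : yok_rel (g i * t j) (t (simple i j) * g i)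
| yok_td (j : 'I_n) : yok_rel (t j ^+ d) (Scal 1%R)
| yok_quad (i : 'I_n.-1) :
    yok_rel (g i ^+ 2) (Scal (u ^+ 2)%R + Scal v * term_e i * g i).

End YokRel.

Lemma yok_nontriv n : ~ cong (@yok_rel n) (Scal 1) (Scal 0).
Proof.
pose c : A := lcst (d%:R^-1) *+ d.
have [M HM] := companion_quad (u ^+ 2) (v * c).
pose f (x : ygen n) : 'M[A]_2 := if x is gen_g _ then M else 1.
move=> /(@cong_teval _ _ _ _ f) H.
have /eqP : (1%:A : 'M[A]_2) = 0%:A.
  apply: H => s t.
  case=> [i j _|i j _|i j|i j|j|i] //=; first by rewrite mulr1 mul1r.
    by rewrite teval_iter /= expr1n scale1r.
  rewrite scale1r mulr1 HM; congr (_ + _ * _).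
  rewrite teval_sum (eq_bigr (fun=> 1)); last first.
    by move=> s' _ /=; rewrite !teval_iter /= !expr1n mulr1.
  rewrite sumr_const card_ord -!scalerAl !mul1r !scalerA.
  by rewrite -scaler_nat !scalerA /c mulr_natr mulrnAr.
by rewrite scale1r scale0r oner_eq0.
Qed.

Definition yok_pres n : presentation A := Presentation (@yok_nontriv n).

Definition yokonuma n : Type := palg (yok_pres n).
HB.instance Definition _ n := GRing.Algebra.on (yokonuma n).

Definition geng n (i : 'I_n.-1) : yokonuma n := pelt (yok_pres n) (gen_g i).
Definition gent n (j : 'I_n) : yokonuma n := pelt (yok_pres n) (gen_t j).

Definition gw n (w : 'S_n) : yokonuma n := \prod_(i <- redword w) geng i.
Definition tildeg n (w : 'S_n) : yokonuma n := uV ^+ ell w *: gw w.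

Context (xi : unity_roots C d) (n : nat).

Definition E1 (j : 'I_n) (a : 'I_d) : yokonuma n :=
  lcst (d%:R^-1) *: \sum_(s < d) lcst (xi a ^+ s) *: gent j ^+ (d - s).

Definition Echi (chi : tchar d n) : yokonuma n := \prod_(j < n) E1 j (chi j).

Definition Emu (mu : Comp d n) : yokonuma n := \sum_(chi | has_comp mu chi) Echi chi.

Lemma gent_comm i j : GRing.comm (gent i) (gent j : yokonuma n).
Proof. exact: (palg_rel (P := yok_pres n) (yok_tt i j)). Qed.

Lemma gentX j : gent j ^+ d = 1 :> yokonuma n.
Proof.
have := palg_rel (P := yok_pres n) (yok_td j).
by rewrite teval_iter /= scale1r.
Qed.

Lemma geng_gent i j : geng i * gent j = gent (simple i j) * geng i :> yokonuma n.
Proof. exact: (palg_rel (P := yok_pres n) (yok_gt i j)). Qed.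

Lemma commZ (a : A) (x y : yokonuma n) : GRing.comm x y -> GRing.comm x (a *: y).
Proof. by rewrite /GRing.comm -scalerAr -scalerAl => ->. Qed.

Lemma gent_E1_comm i j a : GRing.comm (gent i) (E1 j a).
Proof.
apply/commZ/commr_sum => s _; apply/commZ/commrX; exact: gent_comm.
Qed.

Lemma commr_E1 x j a : GRing.comm x (gent j) -> GRing.comm x (E1 j a).
Proof. by move=> H; apply/commZ/commr_sum => s _; apply/commZ/commrX. Qed.

Lemma E1_comm i j a b : GRing.comm (E1 i a) (E1 j b).
Proof. by apply: commr_E1; apply: commr_sym; apply: gent_E1_comm. Qed.

Lemma gent_E1 j a : gent j * E1 j a = lcst (xi a) *: E1 j a.
Proof.
rewrite /E1 -scalerAr scalerA [in RHS]mulrC -scalerA; congr (_ *: _).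
under eq_bigr do rewrite rmorphXn.
by apply: shift_sum; [rewrite -rmorphXn urootX rmorph1 | apply: gentX].
Qed.

Lemma E1_eigen j a b (x : yokonuma n) :
  gent j * x = lcst (xi a) *: x -> E1 j b * x = if b == a then x else 0.
Proof.
move=> Hx.
have HX k : gent j ^+ k * x = lcst (xi a ^+ k) *: x.
  elim: k => [|k IH]; first by rewrite !expr0 mul1r rmorph1 scale1r.
  by rewrite exprSr -mulrA Hx -scalerAr IH scalerA -rmorphM exprS.
rewrite /E1 -scalerAl mulr_suml.
rewrite (eq_bigr (fun s : 'I_d => lcst (xi b ^+ s * xi a ^+ (d - s)) *: x)); last first.
  by move=> s _; rewrite -scalerAl HX scalerA -rmorphM.
rewrite -scaler_suml scalerA -rmorph_sum -rmorphM root_sum.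
case: eqP => _; last by rewrite mulr0 rmorph0 scale0r.
rewrite mulVf ?rmorph1 ?scale1r // pnatr_eq0 -lt0n.
exact: leq_ltn_trans (leq0n a) (ltn_ord a).
Qed.

(* Products of commuting factors E1 are compared through the action of the t_j. *)
Lemma gent_prod (r : seq 'I_n) (f : 'I_n -> 'I_n) (c : 'I_n -> 'I_d) k :
  k \in r ->
  gent (f k) * \prod_(j <- r) E1 (f j) (c j) =
  lcst (xi (c k)) *: \prod_(j <- r) E1 (f j) (c j).
Proof.
elim: r => // j r IH; rewrite big_cons in_cons; case/predU1P => [->|kr].
  by rewrite mulrA gent_E1 scalerAl.
by rewrite mulrA gent_E1_comm -mulrA IH // scalerAr.
Qed.

Lemma prod_eigen (r : seq 'I_n) (f : 'I_n -> 'I_n) (c c' : 'I_n -> 'I_d) x :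
  (forall j, gent (f j) * x = lcst (xi (c' j)) *: x) ->
  (\prod_(j <- r) E1 (f j) (c j)) * x = if all (fun j => c j == c' j) r then x else 0.
Proof.
move=> Hx; elim: r => [|j r IH] /=; first by rewrite big_nil mul1r.
rewrite big_cons -mulrA IH; case: (all _ r); last by rewrite mulr0 andbF.
by rewrite andbT; apply: E1_eigen.
Qed.

Lemma gent_Echi k chi : gent k * Echi chi = lcst (xi (chi k)) *: Echi chi.
Proof. by rewrite /Echi (gent_prod id) // mem_index_enum. Qed.

Lemma EchiM chi chi' : Echi chi * Echi chi' = if chi == chi' then Echi chi else 0.
Proof.
rewrite {1}/Echi (prod_eigen _ _ (f := id) (c' := chi')); last by move=> j; apply: gent_Echi.
have -> : all (fun j => chi j == chi' j) (index_enum 'I_n) = (chi == chi').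
  apply/allP/eqP => [H|-> //]; apply/ffunP => j.
  by apply/eqP/H; rewrite mem_index_enum.
by case: eqP => [->|].
Qed.

Lemma commr_prodE1 x (r : seq 'I_n) (f : 'I_n -> 'I_n) (c : 'I_n -> 'I_d) :
  (forall j, GRing.comm x (gent j)) ->
  GRing.comm x (\prod_(j <- r) E1 (f j) (c j)).
Proof. by move=> H; apply: commr_prod => j _; apply: commr_E1. Qed.

Lemma geng_E1 i j a : geng i * E1 j a = E1 (simple i j) a * geng i.
Proof.
have H k : geng i * gent j ^+ k = gent (simple i j) ^+ k * geng i.
  elim: k => [|k IH]; first by rewrite !expr0 mulr1 mul1r.
  by rewrite !exprS mulrA geng_gent -mulrA IH mulrA.
rewrite /E1 -scalerAr -scalerAl; congr (_ *: _).
rewrite mulr_sumr mulr_suml; apply: eq_bigr => s _.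
by rewrite -scalerAr -scalerAl H.
Qed.

Lemma geng_Echi i chi :
  geng i * Echi chi = Echi (char_act (simple i) chi) * geng i.
Proof.
pose F r := \prod_(j <- r) E1 (simple i j) (chi j).
have HF r : geng i * (\prod_(j <- r) E1 j (chi j)) = F r * geng i.
  rewrite /F; elim: r => [|j r IH]; first by rewrite !big_nil mulr1 mul1r.
  by rewrite !big_cons mulrA geng_E1 -mulrA IH mulrA.
rewrite {1}/Echi HF; congr (_ * _).
set psi := char_act _ _; set r := index_enum _.
have psiE j : psi (simple i j) = chi j.
  by rewrite ffunE /simple tpermV -/(simple i) simpleK.
have FE : F r * Echi psi = Echi psi.
  rewrite /F (prod_eigen _ _ (c' := chi)); first by rewrite (introT allP).
  by move=> j; rewrite gent_Echi psiE.
have EF : Echi psi * F r = F r.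
  rewrite /Echi (prod_eigen _ _ (f := id) (c' := psi)); first by rewrite (introT allP).
  move=> j; rewrite -[in LHS](simpleK i j) /F gent_prod ?mem_index_enum //.
  by rewrite -psiE simpleK.
rewrite -EF -[RHS]FE; apply: commr_sym.
apply: (@commr_prodE1 _ _ id) => j; apply: commr_sym.
by apply: commr_prodE1 => k; apply: gent_comm.
Qed.

Lemma Emu_comm mu x : GRing.comm (Emu mu) x.
Proof.
elim/pclassW: x => s; rewrite pclassE.
elim: s => [a|[i|j]|s IHs t IHt|s IHs t IHt] /=.
- by apply/commZ/commr1.
- rewrite /GRing.comm -/(geng i) /Emu mulr_sumr mulr_suml.
  pose h := @char_act d n (simple i).
  have hK : involutive h.
    move=> chi; apply/ffunP => j; rewrite !ffunE /simple tpermV.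
    by congr (chi _); apply: tpermK.
  rewrite (reindex_inj (inv_inj hK)) /=.
  by apply: eq_big => [chi|chi _]; rewrite ?has_comp_act // geng_Echi.
- rewrite -/(gent j); apply: commr_sym; apply: commr_sum => chi _.
  by apply: (@commr_prodE1 _ _ id) => k; apply: gent_comm.
- exact: commrD.
- exact: commrM.
Qed.

Lemma Emu_idem mu : Emu mu * Emu mu = Emu mu.
Proof.
rewrite {1 3}/Emu mulr_suml; apply: eq_bigr => chi Hchi.
rewrite /Emu mulr_sumr (bigD1 chi) //= EchiM eqxx big1 ?addr0 // => psi /andP [_ H].
by rewrite EchiM eq_sym (negPf H).
Qed.

Section Corner.
Context (mu : Comp d n).

Definition in_EY : pred (yokonuma n) := fun y => `[< exists z, y = Emu mu * z >].

Lemma in_EYP y : reflect (Emu mu * y = y) (in_EY y).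
Proof.
apply: (iffP idP) => [/asboolP [z ->]|Hy]; first by rewrite mulrA Emu_idem.
by apply/asboolP; exists y.
Qed.

Lemma in_EY_submod : submod_closed in_EY.
Proof.
split=> [|a x y /in_EYP Hx /in_EYP Hy]; apply/in_EYP; first by rewrite mulr0.
by rewrite mulrDr -scalerAr Hx Hy.
Qed.

HB.instance Definition _ :=
  GRing.isSubmodClosed.Build A (yokonuma n) in_EY in_EY_submod.

Record EY : Type := EYSub { yval : yokonuma n; _ : in_EY yval }.

HB.instance Definition _ := [isSub for yval].
HB.instance Definition _ := [Choice of EY by <:].
HB.instance Definition _ := [SubChoice_isSubLmodule of EY by <:].

Lemma projE_subproof y : in_EY (Emu mu * y).
Proof. by apply/asboolP; exists y. Qed.

Definition projE (y : yokonuma n) : EY := EYSub (projE_subproof y).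

Lemma evalK (x : EY) : Emu mu * yval x = yval x.
Proof. by case: x => x /= /in_EYP. Qed.

Lemma mulE_subproof (x y : EY) : in_EY (yval x * yval y).
Proof. by apply/in_EYP; rewrite mulrA evalK. Qed.

Definition mulE (x y : EY) : EY := EYSub (mulE_subproof x y).

Lemma oneE_subproof : in_EY (Emu mu).
Proof. by apply/in_EYP; apply: Emu_idem. Qed.

Definition oneE : EY := EYSub oneE_subproof.

Lemma mulEA : associative mulE.
Proof. by move=> x y z; apply: val_inj; rewrite /= mulrA. Qed.
Lemma mul1E : left_id oneE mulE.
Proof. by move=> x; apply: val_inj; rewrite /= evalK. Qed.
Lemma mulE1 : right_id oneE mulE.
Proof. by move=> x; apply: val_inj; rewrite /= -Emu_comm evalK. Qed.
Lemma mulEDl : left_distributive mulE +%R.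
Proof. by move=> x y z; apply: val_inj; rewrite /= mulrDl. Qed.
Lemma mulEDr : right_distributive mulE +%R.
Proof. by move=> x y z; apply: val_inj; rewrite /= mulrDr. Qed.

HB.instance Definition _ := GRing.Zmodule_isPzRing.Build EY
  mulEA mul1E mulE1 mulEDl mulEDr.

Context (p : 'I_(multinom mu) -> 'S_n).

Definition chik (k : 'I_(multinom mu)) : tchar d n := char_act (p k) (chi1 mu).

Definition Phi_spec (f : MatH C mu -> EY) : Prop :=
  forall (w : 'S_n) (i j : 'I_(multinom mu)) (M : MatH C mu),
    w \in Young mu -> is_elem M (tildeT C w) i j ->
    yval (f M) = Echi (chik i) * tildeg (pcomp (pcomp (p i) w) (p j)^-1%g)
                 * Echi (chik j).

Definition Psi_spec (f : EY -> MatH C mu) : Prop :=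
  forall (w : 'S_n) (k j : 'I_(multinom mu)) (y : EY),
    char_act w (chik j) = chik k -> yval y = Echi (chik k) * tildeg w ->
    is_elem (f y) (tildeT C (pcomp (pcomp (p k)^-1%g w) (p j))) k j.

End Corner.

Definition Phi_sum (Phi : forall mu, MatH C mu -> EY mu)
  (x : DirSum C d n) : yokonuma n := \sum_mu yval (Phi mu (x mu)).

(* y is identified with its components E_mu y. *)
Definition Psi_sum (Psi : forall mu, EY mu -> MatH C mu)
  (y : yokonuma n) : DirSum C d n := [ffun mu => Psi mu (projE mu y)].

End Yokonuma.

(* Main.v *)
(* Let w act on the characters, and let pi_k carry chi_1 to chi_k.  If s_i moves
   chi, then e_i E_chi = 0, so the quadratic relation becomes g~_i g~_i E_chi = E_chi
   and lengths no longer matter.  Every letter of a reduced word of the minimal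
   representative pi_k moves the character it meets, hence
     E_(chi_i) g~_(pi_i w pi_j^-1) = g~_(pi_i) (g~_w E_(chi_1)) Z_j,
     Z_j = g~_(pi_j^-1) E_(chi_j),   Z_j g~_(pi_k) E_(chi_1) = delta_(jk) E_(chi_1).
   So Phi is multiplicative because T~_w |-> g~_w E_(chi_1) is multiplicative on H^mu,
   where e_i E_(chi_1) = E_(chi_1) turns one quadratic relation into the other.
   Phi and Psi match bases; the E_chi g~_w are a basis because Y acts on functions on
   the pairs (chi, w), and the T~_w are independent because T_i |-> g_i maps H_n to
   the Yokonuma--Hecke algebra with d = 1. *)

Require Import Defs.
From HB Require Import structures.
From mathcomp Require Import all_fingroup all_boot all_order all_algebra.
From mathcomp Require Import boolp reals complex zify ring.
(* ssrfun's pcomp would otherwise hide the product of permutations pcomp. *)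
Import Defs.

Set Implicit Arguments.
Unset Strict Implicit.
Unset Printing Implicit Defensive.

Import Order.TTheory GRing.Theory Num.Theory.
Local Open Scope ring_scope.

(** * Lengths and reduced words *)

(** The obstacle is that lengths need not add up in $\pi_iw\pi_j^{-1}$ (take $i=j$ and $w=1$), so
    multiplication along reduced words breaks down at the factor $\pi_j^{-1}$. The vanishing of the
    quadratic term replaces it, since that argument asks nothing of lengths. Minimality of $\pi_k$
    is what makes its letters move characters: a letter fixing the character it meets could be
    deleted without leaving the coset. Independence is obtained as explicit coordinate functions.
    With them $\Psi_\mu$ and the map $\tilde T_w\mapsto\tilde g_wE_{\chi_1}$ are linear by
    construction and defined everywhere, and spanning alone then gives the uniqueness of the
    specified maps and both inverse identities. The roots $\xi_a$ are known only as $d$ distinct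
    solutions of $x^d=1$. Their orthogonality in one order makes the $E_\chi$ orthogonal, in the
    other order it gives $\sum_\chi E_\chi=1$, on which both spanning and the sum over $\mu$
    rest. *)

Section Combinatorics.
Context (n : nat).
Implicit Types (i j : 'I_n.-1) (w x y : 'S_n) (s t : seq 'I_n.-1).

Lemma pcompA w x y : pcomp w (pcomp x y) = pcomp (pcomp w x) y.
Proof. by rewrite /pcomp mulgA. Qed.

Lemma pcomp1w w : pcomp 1%g w = w.
Proof. exact: mulg1. Qed.

Lemma pcompw1 w : pcomp w 1%g = w.
Proof. exact: mul1g. Qed.

Lemma pcompKV w x : pcomp (pcomp w x) x^-1%g = w.
Proof. exact: mulKg. Qed.

Lemma pcompVK w x : pcomp (pcomp w x^-1%g) x = w.
Proof. exact: mulKVg. Qed.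

Lemma pcompK w x : pcomp w^-1%g (pcomp w x) = x.
Proof. exact: mulgK. Qed.

Lemma pcompVV w x : pcomp w (pcomp w^-1%g x) = x.
Proof. exact: mulgKV. Qed.

Lemma simpleV i : (simple i)^-1%g = simple i.
Proof. exact: tpermV. Qed.

Lemma pcomp_simpleK i w : pcomp (simple i) (pcomp (simple i) w) = w.
Proof. by rewrite -{1}[simple i]simpleV pcompK. Qed.

Lemma pcomp_simpleKr i w : pcomp (pcomp w (simple i)) (simple i) = w.
Proof. by rewrite -{2}[simple i]simpleV pcompKV. Qed.

Lemma invgpcomp w x : (pcomp w x)^-1%g = pcomp x^-1%g w^-1%g.
Proof. exact: invMg. Qed.

Lemma lo_hi i : lo i != hi i.
Proof. by rewrite -val_eqE /= neq_ltn ltnSn. Qed.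

Lemma simple_lo i : simple i (lo i) = hi i.
Proof. exact: tpermL. Qed.

Lemma simple_hi i : simple i (hi i) = lo i.
Proof. exact: tpermR. Qed.

Lemma simpleD i (a : 'I_n) : (a != i :> nat) -> (a != i.+1 :> nat) -> simple i a = a.
Proof. by move=> Hl Hh; rewrite /simple tpermD // -val_eqE /= eq_sym. Qed.

(** Stated by positions, so that it can be computed for products; [ell_up] and [ell_down] identify
    it with the drop of the length under left multiplication by $s_i$. *)
Definition ldesc i w : bool := (w^-1%g (hi i) < w^-1%g (lo i))%N.

Lemma pcompV_simple i w (a : 'I_n) : (pcomp (simple i) w)^-1%g a = w^-1%g (simple i a).
Proof. by rewrite invgpcomp simpleV pcompE. Qed.

Lemma ldesc_simple i w : ldesc i (pcomp (simple i) w) = ~~ ldesc i w.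
Proof.
rewrite /ldesc !pcompV_simple simple_lo simple_hi ltn_neqAle -leqNgt.
by rewrite val_eqE (inj_eq perm_inj) lo_hi.
Qed.

(** These are the inversions of $w^{-1}$, which left multiplication of $w$ by $s_i$ merely relabels,
    except for one pair. *)
Definition invs w : {set 'I_n * 'I_n} :=
  [set ab : 'I_n * 'I_n | (ab.1 < ab.2)%N && (w^-1%g ab.2 < w^-1%g ab.1)%N].

Lemma simpleE i (a : 'I_n) : simple i a = (if a == i :> nat then i.+1
   else if a == i.+1 :> nat then i : nat else a) :> nat.
Proof.
rewrite /simple; case: tpermP => [->|->|]; rewrite ?eqxx //=.
  by rewrite eqn_leq ltnn.
by move=> /eqP + /eqP; rewrite -!val_eqE /= => /negPf -> /negPf ->.
Qed.

Lemma simple_mono i (a b : 'I_n) : (a < b)%N -> (a, b) != (lo i, hi i) ->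
  (simple i a < simple i b)%N.
Proof.
move=> ab; rewrite xpair_eqE negb_and -!val_eqE /= !simpleE => H.
by repeat (case: ifP => ?); lia.
Qed.

(** The pair $(i,i+1)$ is an inversion for exactly one of $w$ and $s_iw$. Applying $s_i$ to both
    letters matches all the other inversions; one inclusion, used for both permutations, gives equal
    cardinalities. *)
Lemma invs_simple i w :
  (#|invs (pcomp (simple i) w)| + ldesc i w = #|invs w| + ~~ ldesc i w)%N.
Proof.
pose f (ab : 'I_n * 'I_n) := (simple i ab.1, simple i ab.2).
have fK : involutive f by case=> a b; rewrite /f /= !simpleK.
pose z := (lo i, hi i).
have zE x : (z \in invs x) = ldesc i x by rewrite inE /= ltnSn.
have sub x : f @: (invs x :\ z) \subset invs (pcomp (simple i) x) :\ z.
  apply/subsetP => _ /imsetP [[a b] + ->]; rewrite !inE /= => /and3P [Hz ab H].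
  rewrite !pcompV_simple !simpleK H simple_mono // andbT andbT.
  apply/eqP => -[Ha Hb]; have : (a < b)%N by [].
  by rewrite -(simpleK i a) -(simpleK i b) Ha Hb simple_lo simple_hi /= ltnNge leqnSn.
have le x : (#|invs x :\ z| <= #|invs (pcomp (simple i) x) :\ z|)%N.
  by rewrite -(card_imset _ (inv_inj fK)); apply/subset_leq_card/sub.
have E : #|invs (pcomp (simple i) w) :\ z| = #|invs w :\ z|.
  by apply/eqP; rewrite eqn_leq le -{2}(pcomp_simpleK i w) le.
rewrite (cardsD1 z (invs w)) (cardsD1 z (invs (pcomp _ _))) !zE E ldesc_simple.
by case: (ldesc i w); rewrite /= ?addn0 ?add0n ?add1n ?addn1.
Qed.

Lemma invs1 : invs 1%g = set0.
Proof.
by apply/setP => -[a b]; rewrite !inE /= invg1 !perm1; case: ltngtP.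
Qed.

(** Without descents $w^{-1}$ is increasing, so $a\le w^{-1}(a)$ for all $a$. Both sides have the
    same sum over $a$, which forces equality termwise. *)
Lemma mono_perm_id w : (forall i, ~~ ldesc i w) -> w = 1%g.
Proof.
move=> H.
have mono k (a b : 'I_n) : (b = a + k.+1 :> nat)%N -> (w^-1%g a < w^-1%g b)%N.
  elim: k b => [|k IH] b Hb.
    have ai : (a < n.-1)%N by have := ltn_ord b; lia.
    have := H (Ordinal ai); rewrite /ldesc -leqNgt.
    have -> : lo (Ordinal ai) = a by apply: val_inj.
    have -> : hi (Ordinal ai) = b by apply: val_inj => /=; lia.
    move=> le; rewrite ltn_neqAle le andbT val_eqE (inj_eq perm_inj) -val_eqE /=; lia.
  have cn : (a + k.+1 < n)%N by have := ltn_ord b; lia.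
  have ci : (a + k.+1 < n.-1)%N by have := ltn_ord b; lia.
  apply: leq_trans (IH (Ordinal cn) erefl) _.
  have := H (Ordinal ci); rewrite /ldesc -leqNgt.
  have -> : lo (Ordinal ci) = Ordinal cn by apply: val_inj.
  have -> // : hi (Ordinal ci) = b by apply: val_inj => /=; lia.
have ge k : forall a : 'I_n, (a = k :> nat)%N -> (a <= w^-1%g a)%N.
  elim: k => [|k IH] a Ha; first by rewrite Ha.
  have kn : (k < n)%N by rewrite ltnW // -Ha.
  have := mono 0 (Ordinal kn) a; rewrite addn1 => /(_ Ha).
  have := IH (Ordinal kn) erefl => /=; lia.
have : (\sum_(a : 'I_n) w^-1%g a = \sum_(a : 'I_n) a)%N.
  by rewrite [RHS](reindex_inj (@perm_inj _ w^-1%g)).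
move=> E; suff H1 : (w^-1)%g = 1%g :> 'S_n by rewrite -[w]invgK H1 invg1.
apply/perm.permP => a; rewrite perm1; apply: val_inj.
have := leqif_sum (fun (b : 'I_n) (_ : true) => leqif_eq (ge b b erefl)).
by rewrite E => /leqif_refl /forallP /(_ a) /eqP.
Qed.

(** Each letter of a word creates at most one inversion. Conversely, stripping a left descent
    removes exactly one, and a permutation without descents is the identity. *)
Lemma ell_invs w : ell w = #|invs w|.
Proof.
apply/eqP; rewrite eqn_leq; apply/andP; split; last first.
  rewrite -(size_redword w) -{1}(redwordK w); elim: (redword w) => [|i s IH] /=.
    by rewrite invs1 cards0.
  rewrite -ltnS (leq_ltn_trans (leq_addr (ldesc i (word_perm s)) _)) // invs_simple.
  by rewrite ltnS -[X in (_ <= X)%N]addn1 leq_add ?leq_b1.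
move: {2}_.+1 (ltnSn #|invs w|) => m; elim: m w => // m IH w Hm.
have [/existsP [i Hi]|] := boolP [exists i, ldesc i w]; last first.
  rewrite negb_exists => /forallP /mono_perm_id ->.
  by apply: leq_trans (ell_min [::]) _.
have := invs_simple i w; rewrite Hi /= addn0 addn1 => E.
rewrite -E ltnS in Hm *.
have := ell_min (i :: redword (pcomp (simple i) w)).
rewrite /= redwordK pcomp_simpleK size_redword => /leq_trans -> //.
by rewrite ltnS IH.
Qed.

Lemma ell_simple i w :
  (ell (pcomp (simple i) w) + ldesc i w = ell w + ~~ ldesc i w)%N.
Proof. by rewrite !ell_invs invs_simple. Qed.

Lemma ell_up i w : ~~ ldesc i w -> ell (pcomp (simple i) w) = (ell w).+1.
Proof. by move=> H; have := ell_simple i w; rewrite H (negPf H) addn0 addn1. Qed.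

Lemma ell_down i w : ldesc i w -> ell w = (ell (pcomp (simple i) w)).+1.
Proof. by move=> H; have := ell_simple i w; rewrite H addn0 addn1. Qed.

Lemma ell1 : ell (1%g : 'S_n) = 0.
Proof. by rewrite ell_invs invs1 cards0. Qed.

Lemma word_perm_rev s : word_perm (rev s) = (word_perm s)^-1%g.
Proof.
elim: s => [|i s IH] /=; first by rewrite invg1.
by rewrite rev_cons -cats1 word_perm_cat IH invgpcomp /= pcompw1 simpleV.
Qed.

Lemma ellV w : ell w^-1%g = ell w.
Proof.
suff le x : (ell x^-1%g <= ell x)%N.
  by apply/eqP; rewrite eqn_leq le -{1}(invgK w) le.
by rewrite -{1}(redwordK x) -word_perm_rev -(size_redword x) -size_rev ell_min.
Qed.

Lemma simpleV_r i w : pcomp w (simple i) = (pcomp (simple i) w^-1%g)^-1%g.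
Proof. by rewrite invgpcomp invgK simpleV. Qed.

Lemma ell_upr i w : ~~ ldesc i w^-1%g -> ell (pcomp w (simple i)) = (ell w).+1.
Proof. by move=> H; rewrite simpleV_r ellV ell_up // ellV. Qed.

Lemma ell_downr i w : ldesc i w^-1%g -> ell w = (ell (pcomp w (simple i))).+1.
Proof. by move=> H; rewrite simpleV_r ellV -ell_down // ellV. Qed.

Definition reduced s : bool := size s == ell (word_perm s).

Lemma redword_reduced w : reduced (redword w).
Proof. by rewrite /reduced redwordK size_redword. Qed.

Lemma reduced_cons i s : reduced (i :: s) -> reduced s /\ ldesc i (word_perm (i :: s)).
Proof.
rewrite /reduced /= ldesc_simple => /eqP H.
have := ell_min s; have := ell_simple i (word_perm s).
by case: (ldesc _ _) => /=; split=> //; lia.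
Qed.

Lemma reduced_consE i w s : word_perm s = pcomp (simple i) w -> reduced s -> ldesc i w ->
  word_perm (i :: s) = w /\ reduced (i :: s).
Proof.
move=> Hs rs Hi; have E : word_perm (i :: s) = w by rewrite /= Hs pcomp_simpleK.
by split=> //; rewrite /reduced E (ell_down Hi) -Hs /= eqSS.
Qed.

End Combinatorics.

(** * Matsumoto's theorem *)

Section Matsumoto.
Context (n : nat).
Implicit Types (i j : 'I_n.-1) (w : 'S_n) (s t : seq 'I_n.-1).

Lemma simple_far i j : (i.+1 < j)%N ->
  [/\ simple i (lo j) = lo j, simple i (hi j) = hi j,
      simple j (lo i) = lo i & simple j (hi i) = hi i].
Proof. by move=> H; split; apply: simpleD => /=; lia. Qed.

Lemma simple_next i j : j = i.+1 :> nat ->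
  [/\ lo j = hi i, simple i (hi j) = hi j & simple j (lo i) = lo i].
Proof.
by move=> H; split; [apply: val_inj; rewrite /= H | apply: simpleD => /=; lia ..].
Qed.

Lemma simpleJ i j : (simple i * simple j * simple i)%g = tperm (simple i (lo j)) (simple i (hi j)).
Proof. by rewrite -{1}[simple i]simpleV -mulgA -/(conjg _ _) tpermJ. Qed.

Lemma pcomp_comm i j w : (i.+1 < j)%N ->
  pcomp (simple i) (pcomp (simple j) w) = pcomp (simple j) (pcomp (simple i) w).
Proof.
move=> H; rewrite !pcompA; congr (pcomp _ _); have [lj hj _ _] := simple_far H.
rewrite /pcomp; apply: (mulgI (simple i)).
by rewrite !mulgA simpleJ lj hj -[LHS]mul1g -(mulgV (simple i)) simpleV.
Qed.

Lemma pcomp_braid i j w : j = i.+1 :> nat ->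
  pcomp (simple i) (pcomp (simple j) (pcomp (simple i) w)) =
  pcomp (simple j) (pcomp (simple i) (pcomp (simple j) w)).
Proof.
move=> H; rewrite !pcompA; congr (pcomp _ _); have [lj hj li] := simple_next H.
by rewrite /pcomp !mulgA !simpleJ {1}lj hj li simple_hi -lj simple_lo.
Qed.

Context (B : pzRingType) (f : 'I_n.-1 -> B).
Hypothesis f_comm : forall i j, (i.+1 < j)%N -> f i * f j = f j * f i.
Hypothesis f_braid : forall i j, j = i.+1 :> nat -> f i * f j * f i = f j * f i * f j.

(** Induction on the length. If the first letters $i<j$ differ, both are left descents of $w$, and
    the induction hypothesis lets the tails be rewritten until the two words begin with the two
    sides of a commutation or braid relation and end with reduced words of the same element. *)
Lemma matsumoto s t : reduced s -> reduced t -> word_perm s = word_perm t ->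
  \prod_(i <- s) f i = \prod_(i <- t) f i.
Proof.
move: {2}_.+1 (ltnSn (size s)) => m; elim: m s t => // m IH s t Hm rs rt E.
have Hst : size s = size t by rewrite (eqP rs) (eqP rt) E.
case: s t => [|i s] [|j t] // in Hm rs rt E Hst *.
have [rs' Hi] := reduced_cons rs; have [rt' Hj] := reduced_cons rt.
have [Hs Ht] : (size s < m)%N /\ (size t < m)%N by move: Hm Hst => /=; lia.
have Es : word_perm s = pcomp (simple i) (word_perm (i :: s)) by rewrite pcomp_simpleK.
have Et : word_perm t = pcomp (simple j) (word_perm (i :: s)).
  by rewrite E pcomp_simpleK.
rewrite -E in Hj; move: {E} (word_perm _) Hi Hj Es Et => w Hi Hj Es Et.
(* A short reduced word may be replaced by one that begins with any prescribed left descent of its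
   permutation. *)
have step k r x : reduced r -> (size r < m)%N -> word_perm r = x -> ldesc k x ->
    exists2 r', \prod_(l <- r) f l = f k * \prod_(l <- r') f l
              & reduced r' /\ word_perm r' = pcomp (simple k) x.
  move=> rr Hr Er Hk; have rr' := redword_reduced (pcomp (simple k) x).
  have [E1 E2] := reduced_consE (redwordK _) rr' Hk.
  exists (redword (pcomp (simple k) x)); last by rewrite redwordK.
  by rewrite (IH _ _ Hr rr E2) ?big_cons // Er E1.
have eqr r r' : (size r < m)%N -> reduced r -> reduced r' -> word_perm r = word_perm r' ->
    \prod_(l <- r) f l = \prod_(l <- r') f l by move=> *; apply: IH.
have sz (k : 'I_n.-1) (r r' : seq 'I_n.-1) (x : 'S_n) :
    reduced r -> reduced r' -> word_perm r = x ->
    word_perm r' = pcomp (simple k) x -> ldesc k x -> (size r < m)%N -> (size r' < m)%N.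
  move=> /eqP rr /eqP rr' Er Er' Hk; rewrite rr' Er' rr Er (ell_down Hk); exact: ltnW.
wlog ij : i j s t Hi Hj Es Et rs' rt' Hs Ht {rs rt Hm Hst} / (i <= j)%N.
  move=> H; case/orP: (leq_total i j) => Hij; first exact: H.
  by symmetry; apply: H.
rewrite !big_cons.
have [ij' | ij'] := eqVneq i j.
  by subst j; congr (_ * _); apply: IH; rewrite // Es Et.
have {ij ij'} ij : (i < j)%N by rewrite ltn_neqAle ij andbT.
have [far|near] := ltnP i.+1 j.
  have [lj hj li hi'] := simple_far far.
  have Hj' : ldesc j (pcomp (simple i) w) by rewrite /ldesc !pcompV_simple lj hj.
  have Hi' : ldesc i (pcomp (simple j) w) by rewrite /ldesc !pcompV_simple li hi'.
  have [s' -> [rs1 Es1]] := step _ _ _ rs' Hs Es Hj'.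
  have [t' -> [rt1 Et1]] := step _ _ _ rt' Ht Et Hi'.
  rewrite !mulrA (f_comm far); congr (_ * _).
  apply: (eqr _ _ (sz _ _ _ _ rs' rs1 Es Es1 Hj' Hs) rs1 rt1).
  by rewrite Es1 Et1 (pcomp_comm w far).
have nx : j = i.+1 :> nat by apply/eqP; rewrite eqn_leq near ij.
have [lj si sj] := simple_next nx.
(* For $j=i+1$ the two descents say that $w^{-1}$ reverses the order of the three letters
   $i,i+1,i+2$, so a whole braid word can be stripped from $w$ in either form. *)
have abc : [/\ w^-1%g (hi j) < w^-1%g (lo j), w^-1%g (hi i) < w^-1%g (lo i) &
    w^-1%g (hi j) < w^-1%g (lo i)]%N.
  by split=> //; apply: ltn_trans Hi; rewrite -lj.
case: abc => H1 H2 H3.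
have D1 : ldesc j (pcomp (simple i) w).
  by rewrite /ldesc !pcompV_simple lj si simple_hi.
have D2 : ldesc i (pcomp (simple j) (pcomp (simple i) w)).
  by rewrite /ldesc !pcompV_simple -lj simple_lo sj si simple_lo -lj.
have D3 : ldesc i (pcomp (simple j) w).
  by rewrite /ldesc !pcompV_simple -lj simple_lo sj.
have D4 : ldesc j (pcomp (simple i) (pcomp (simple j) w)).
  by rewrite /ldesc !pcompV_simple si simple_hi lj simple_hi sj.
have [s1 -> [rs1 Es1]] := step _ _ _ rs' Hs Es D1.
have Hs1 := sz _ _ _ _ rs' rs1 Es Es1 D1 Hs.
have [s2 -> [rs2 Es2]] := step _ _ _ rs1 Hs1 Es1 D2.
have [t1 -> [rt1 Et1]] := step _ _ _ rt' Ht Et D3.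
have Ht1 := sz _ _ _ _ rt' rt1 Et Et1 D3 Ht.
have [t2 -> [rt2 Et2]] := step _ _ _ rt1 Ht1 Et1 D4.
rewrite !mulrA (f_braid nx); congr (_ * _).
apply: (eqr _ _ (sz _ _ _ _ rs1 rs2 Es1 Es2 D2 Hs1) rs2 rt2).
by rewrite Es2 Et2 (pcomp_braid w nx).
Qed.

End Matsumoto.

(** * Young subgroups as stabilizers, and minimal coset representatives *)

Section YoungCosets.
Context (d n : nat) (mu : Comp d n).
Implicit Types (i j : 'I_n.-1) (w x y : 'S_n) (chi : tchar d n).

Lemma char_actE w chi a : char_act w chi a = chi (w^-1%g a).
Proof. exact: ffunE. Qed.

Lemma char_act1 chi : char_act 1%g chi = chi.
Proof. by apply/ffunP => a; rewrite char_actE invg1 perm1. Qed.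

Lemma char_actM w x chi : char_act (pcomp w x) chi = char_act w (char_act x chi).
Proof. by apply/ffunP => a; rewrite !char_actE invgpcomp pcompE. Qed.

Lemma char_actK w : cancel (@char_act d n w) (char_act w^-1%g).
Proof. by move=> chi; apply/ffunP => a; rewrite !char_actE invgK permK. Qed.

Lemma char_actKV w : cancel (@char_act d n w^-1%g) (char_act w).
Proof. by move=> chi; apply/ffunP => a; rewrite !char_actE invgK permKV. Qed.

Lemma char_actV w chi psi : char_act w chi = psi <-> char_act w^-1%g psi = chi.
Proof.
by split=> <-; apply/ffunP => a; rewrite !char_actE ?invgK ?permK ?permKV.
Qed.

Lemma simple_fix i chi :
  (char_act (simple i) chi == chi) = (chi (lo i) == chi (hi i)).
Proof.
apply/eqP/eqP => [/ffunP /(_ (lo i))|H].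
  by rewrite char_actE simpleV simple_lo.
apply/ffunP => a; rewrite char_actE simpleV /simple.
by case: tpermP => [->|->|].
Qed.

Lemma chi1_block a : a \in block mu (chi1 mu a).
Proof. by rewrite ffunE; apply: (xchooseP (block_ex mu a)). Qed.

Lemma block_disjoint (a : 'I_n) (b c : 'I_d) :
  a \in block mu b -> a \in block mu c -> (b <= c)%N.
Proof.
rewrite !inE => /andP [H1 _] /andP [_ H2]; rewrite leqNgt; apply/negP => cb.
suff H : (\sum_(e < d | (e <= c)%N) mu e <= \sum_(e < d | (e < b)%N) mu e)%N.
  by have := leq_trans H2 (leq_trans H H1); rewrite ltnn.
rewrite [X in (_ <= X)%N](bigID (fun e : 'I_d => (e <= c)%N)) /=.
apply: leq_trans (leq_addr _ _); rewrite leq_eqVlt; apply/orP; left; apply/eqP.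
by apply: eq_bigl => e; case: (leqP e c) => [ec|_]; rewrite ?andbF ?(leq_ltn_trans ec cb).
Qed.

Lemma in_block a b : (a \in block mu b) = (chi1 mu a == b).
Proof.
apply/idP/eqP => [H|<-]; last exact: chi1_block.
by apply/val_inj/eqP; rewrite /= eqn_leq !(@block_disjoint a) // chi1_block.
Qed.

Lemma chi1_mono (a b : 'I_n) : (a <= b)%N -> (chi1 mu a <= chi1 mu b)%N.
Proof.
move=> ab; rewrite leqNgt; apply/negP => H.
have := chi1_block a; have := chi1_block b; rewrite !inE => /andP [_ H1] /andP [H2 _].
have : (\sum_(e < d | (e <= chi1 mu b)%N) mu e <= \sum_(e < d | (e < chi1 mu a)%N) mu e)%N.
  rewrite [X in (_ <= X)%N](bigID (fun e : 'I_d => (e <= chi1 mu b)%N)) /=.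
  apply: leq_trans (leq_addr _ _); rewrite leq_eqVlt; apply/orP; left; apply/eqP.
  apply: eq_bigl => e; case: (leqP e (chi1 mu b)) => [ec|_]; rewrite ?andbF //.
  by rewrite (leq_ltn_trans ec H).
lia.
Qed.

Lemma YoungP w : reflect (char_act w (chi1 mu) = chi1 mu) (w \in Young mu).
Proof.
rewrite inE; apply: (iffP forallP) => [H|H a].
  apply/ffunP => a; rewrite char_actE; apply/eqP.
  rewrite -in_block -(mem_imset _ _ (@perm_inj _ w)) permKV (eqP (H _)).
  exact: chi1_block.
rewrite eqEcard (card_imset _ (@perm_inj _ w)) leqnn andbT.
apply/subsetP => _ /imsetP [b + ->]; rewrite !in_block => /eqP <-.
by rewrite -[in X in X _ == _]H char_actE permK.
Qed.

Lemma Young1 : 1%g \in Young mu.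
Proof. by apply/YoungP; rewrite char_act1. Qed.

Lemma YoungV w : (w^-1%g \in Young mu) = (w \in Young mu).
Proof. by apply/YoungP/YoungP => /char_actV; rewrite ?invgK. Qed.

Lemma YoungM w x : w \in Young mu -> x \in Young mu -> pcomp w x \in Young mu.
Proof. by move=> /YoungP Hw /YoungP Hx; apply/YoungP; rewrite char_actM Hx. Qed.

Lemma simple_Young i : (simple i \in Young mu) = (chi1 mu (lo i) == chi1 mu (hi i)).
Proof. by rewrite -simple_fix; apply/YoungP/eqP. Qed.

(** [chi1 mu] is nondecreasing and fixed by $w$, hence
    $\chi_1(i+1)=\chi_1(w^{-1}(i+1))\le\chi_1(w^{-1}(i))=\chi_1(i)\le\chi_1(i+1)$. *)
Lemma ldesc_Young i w : w \in Young mu -> ldesc i w -> simple i \in Young mu.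
Proof.
move=> /YoungP Hw Hi; rewrite simple_Young -val_eqE /= eqn_leq chi1_mono //=.
by rewrite -Hw !char_actE chi1_mono // ltnW.
Qed.

(* Every left descent of a parabolic element lies in the parabolic subgroup. *)
Lemma Young_ind (P : 'S_n -> Prop) : P 1%g ->
  (forall i w, simple i \in Young mu -> w \in Young mu -> ~~ ldesc i w ->
     P w -> P (pcomp (simple i) w)) ->
  forall w, w \in Young mu -> P w.
Proof.
move=> P1 PS w; move: {2}_.+1 (ltnSn (ell w)) => m; elim: m w => // m IH w Hm wY.
have [/existsP [i Hi]|] := boolP [exists i, ldesc i w]; last first.
  by rewrite negb_exists => /forallP /mono_perm_id ->.
have iY := ldesc_Young wY Hi.
rewrite -(pcomp_simpleK i w); apply: PS; rewrite ?ldesc_simple ?Hi ?YoungM //.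
by apply: IH; [rewrite ltnS (ell_down Hi) in Hm | rewrite YoungM].
Qed.

(** If $w$ reversed two neighbouring letters of a block, $ws_i$ would be a shorter element of the
    coset. Larger distances follow by steps, because blocks are intervals. *)
Lemma minimal_mono w (a b : 'I_n) : minimal_rep mu w -> (a < b)%N ->
  chi1 mu a = chi1 mu b -> (w a < w b)%N.
Proof.
move=> Hw ab; move: (b - a)%N (subnKC (ltnW ab)) => k Hk; move: Hk ab.
elim: k a => [|k IH] a Hk ab Hc; first by lia.
have ai : (a < n.-1)%N by have := ltn_ord b; lia.
pose i := Ordinal ai; have El : lo i = a by apply: val_inj.
have le1 : (chi1 mu (lo i) <= chi1 mu (hi i))%N by apply: chi1_mono => /=.
have le2 : (chi1 mu (hi i) <= chi1 mu b)%N by apply: chi1_mono.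
have Ec : chi1 mu (hi i) = chi1 mu b.
  by apply/val_inj/eqP; rewrite /= eqn_leq le2 -Hc -El le1.
have iY : simple i \in Young mu by rewrite simple_Young El Ec Hc.
have lt : (w a < w (hi i))%N.
  have : ~~ ldesc i w^-1%g.
    by apply/negP => /ell_downr; have := Hw _ iY; lia.
  rewrite /ldesc invgK El -leqNgt leq_eqVlt val_eqE (inj_eq perm_inj) -El.
  by rewrite (negPf (lo_hi i)).
have [E|ne] := eqVneq (hi i) b; first by rewrite -E.
apply: (ltn_trans lt); apply: IH => //=; first by lia.
by rewrite ltn_neqAle ab andbT; move: ne; rewrite -val_eqE.
Qed.

Lemma ell_minimal w x : minimal_rep mu w -> x \in Young mu ->
  ell (pcomp w x) = (ell w + ell x)%N.
Proof.
move=> Hw; rewrite -YoungV -[X in pcomp w X]invgK -[ell x]ellV.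
move: (x^-1%g) => {}x; elim/Young_ind: x / => [|i x iY xY Hi IH].
  by rewrite invg1 pcompw1 ell1 addn0.
rewrite invgpcomp simpleV pcompA (ell_up Hi) ell_upr ?IH ?addnS //.
rewrite /ldesc !invgK !pcompE -leqNgt.
have lt : (x^-1%g (lo i) < x^-1%g (hi i))%N.
  by move: Hi; rewrite /ldesc -leqNgt leq_eqVlt val_eqE (inj_eq perm_inj) (negPf (lo_hi i)).
apply/ltnW/minimal_mono => //; rewrite -!char_actE.
by move: (xY) => /YoungP ->; apply/eqP; rewrite -simple_Young.
Qed.

(** Both are shortest in the same coset, hence of equal length. Additivity of lengths for
    $x=w\cdot(w^{-1}x)$ then leaves length $0$ for $w^{-1}x$. *)
Lemma minimal_rep_inj w x : minimal_rep mu w -> minimal_rep mu x ->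
  char_act w (chi1 mu) = char_act x (chi1 mu) -> w = x.
Proof.
move=> Hw Hx E.
have Hy : pcomp w^-1%g x \in Young mu.
  by apply/YoungP; rewrite char_actM -E -char_actM /pcomp mulgV char_act1.
have Ew : ell w = ell x.
  have Hy' : pcomp x^-1%g w \in Young mu by rewrite -YoungV invgpcomp invgK.
  have := Hw _ Hy; have := Hx _ Hy'; rewrite !pcompVV => le1 le2.
  by apply/eqP; rewrite eqn_leq le1 le2.
have := ell_minimal Hw Hy; rewrite pcompVV Ew => /eqP.
rewrite -{1}[ell x]addn0 eqn_add2l => /eqP E0.
rewrite -(pcompVV w x) -(redwordK (pcomp w^-1%g x)).
by rewrite (size0nil (etrans (size_redword _) (esym E0))) /= pcompw1.
Qed.

Lemma minimal_rep_ex w : exists2 x, minimal_rep mu x &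
  char_act x (chi1 mu) = char_act w (chi1 mu).
Proof.
have P1 : pcomp 1%g 1%g \in Young mu by rewrite pcompw1 Young1.
case: (@arg_minnP _ 1%g (fun x => x \in Young mu) (fun x => ell (pcomp w x)) Young1).
move=> x xY Hx; exists (pcomp w x); last by rewrite char_actM (YoungP _ xY).
by move=> y yY; rewrite -pcompA Hx ?YoungM.
Qed.

Lemma has_comp_chi1 : has_comp mu (chi1 mu).
Proof.
apply/forallP => a; apply/eqP.
set p := (\sum_(b < d | (b < a)%N) mu b)%N.
have E : (\sum_(b < d | (b <= a)%N) mu b = p + mu a)%N.
  rewrite (bigD1 a) //= addnC; congr (_ + _)%N; apply: eq_bigl => b.
  by rewrite ltn_neqAle andbC.
have le : (p + mu a <= n)%N.
  rewrite -E -[X in (_ <= X)%N](eqP (valP mu)) -/(part mu).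
  by rewrite [X in (_ <= X)%N](bigID (fun b : 'I_d => (b <= a)%N)) /= leq_addr.
pose f (k : 'I_(mu a)) : 'I_n := Ordinal (leq_trans (etrans (ltn_add2l p k (mu a)) (ltn_ord k)) le).
have f_inj : injective f by move=> k l /(congr1 val) /addnI /val_inj.
rewrite -[RHS]card_ord -cardsT -(card_imset _ f_inj).
apply: eq_card => j; rewrite inE -in_block inE E.
apply/andP/imsetP => [[H1 H2]|[k _ ->]]; last by rewrite /= leq_addr ltn_add2l.
have kP : (j - p < mu a)%N by rewrite ltn_subLR.
by exists (Ordinal kP) => //; apply: val_inj; rewrite /= subnKC.
Qed.

Lemma has_comp_chi1_act chi : has_comp mu chi -> exists w, char_act w (chi1 mu) = chi.
Proof.
move=> /forallP H; have /forallP H1 := has_comp_chi1.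
have cnt (psi : tchar d n) a : count_mem a [tuple psi j | j < n] = #|[set j | psi j == a]|.
  by rewrite cardsE cardE /enum_mem size_filter -enumT /= count_map.
(* Equal multiplicities of values make the two tuples rearrangements of each other. The
   rearrangement acts on positions, so its inverse is the witness. *)
have /tuple_permP [w Hw] : perm_eq [tuple chi j | j < n] [tuple chi1 mu j | j < n].
  by apply/allP => a _ /=; rewrite !cnt (eqP (H a)) (eqP (H1 a)).
exists w^-1%g; apply/ffunP => j; rewrite char_actE invgK.
by rewrite -[RHS](tnth_mktuple chi) (val_inj Hw) !tnth_mktuple.
Qed.

End YoungCosets.

(** * The regular representation *)

Section TermAction.
Context (A : comNzRingType) (P : presentation A) (V : lmodType A).
Context (f : pgen P -> V -> V).

(** Terms act on $V$ by plain functions, products by composition, so that a module is built by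
    checking only linearity of the generators and the relations. *)
Fixpoint tact (t : term A (pgen P)) (v : V) : V :=
  match t with
  | Scal a => a *: v
  | Gen x => f x v
  | Add s t => tact s v + tact t v
  | Mul s t => tact s (tact t v)
  end.

Lemma tact_sum I (r : seq I) (F : I -> term A (pgen P)) v :
  tact (\big[@Add A (pgen P)/Scal 0]_(i <- r) F i) v = \sum_(i <- r) tact (F i) v.
Proof. by elim: r => [|i r IH]; rewrite ?big_nil ?big_cons /= ?scale0r ?IH. Qed.

Hypothesis f_linear : forall x, linear (f x).
Hypothesis f_rel : forall s t, prel s t -> tact s =1 tact t.

Lemma tact_linear t : linear (tact t).
Proof.
elim: t => [a|x|s IHs t IHt|s IHs t IHt] //= b v w.
- by rewrite scalerDr !scalerA mulrC.
- by rewrite IHs IHt scalerDr addrACA.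
- by rewrite IHt IHs.
Qed.

(** Linearity enters for distributivity on the right and for the commutation of scalars with terms;
    the other axioms hold for arbitrary maps. *)
Lemma cong_tact s t : cong (@prel A P) s t -> tact s =1 tact t.
Proof.
have tD r : {morph tact r : v w / v + w}.
  by move=> v w; rewrite -[v]scale1r tact_linear !scale1r.
have tZ r a v : tact r (a *: v) = a *: tact r v.
  have t0 : tact r 0 = 0 by apply: (addrI (tact r 0)); rewrite -tD !addr0.
  by rewrite -[a *: v]addr0 tact_linear t0 addr0.
elim=> {s t} //=.
- by move=> s t _ IH v; rewrite IH.
- by move=> s t r _ IH1 _ IH2 v; rewrite IH1.
- by move=> s s' t t' _ IH1 _ IH2 v; rewrite IH1 IH2.
- by move=> s s' t t' _ IH1 _ IH2 v; rewrite IH1 IH2.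
- by move=> s t r v; rewrite addrA.
- by move=> s t v; rewrite addrC.
- by move=> s v; rewrite scale0r add0r.
- by move=> s v; rewrite scaleN1r addNr scale0r.
- by move=> s t r v; rewrite tD.
- by move=> s v; rewrite scale1r.
- by move=> a b v; rewrite scalerDl.
- by move=> a b v; rewrite scalerA.
- by move=> a s v; rewrite tZ.
Qed.

Definition pact (y : palg P) (v : V) : V := tact (repr y) v.

Lemma pactE t v : pact (@pclass A P t) v = tact t v.
Proof. exact: (cong_tact (repr_pclass t)). Qed.

Lemma pact_gen x v : pact (pelt P x) v = f x v.
Proof. exact: pactE. Qed.

Lemma pactM x y v : pact (x * y) v = pact x (pact y v).
Proof.
elim/pclassW: x => s; elim/pclassW: y => t.
by rewrite -[pclass s * pclass t]/(pmulr _ _) pclassM !pactE.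
Qed.

Lemma pact1 v : pact 1 v = v.
Proof. by rewrite (pactE (Scal 1)) /= scale1r. Qed.

Lemma pact_linear_l v : linear (pact^~ v).
Proof.
move=> a x y; elim/pclassW: x => s; elim/pclassW: y => t.
by rewrite -[a *: pclass s]/(pscale _ _) pclassZ
  -[pclass _ + pclass _]/(padd _ _) pclassD !pactE.
Qed.

End TermAction.

Section RegularModule.
Context (C : numFieldType) (d n : nat) (xi : unity_roots C d).
Local Notation A := (laurent C).
Local Notation u := (lu C).
Local Notation v := (lv C).

Definition label : Type := (tchar d n * 'S_n)%type.
HB.instance Definition _ := Finite.on label.
Definition regmod : Type := {ffun label -> A^o}.
HB.instance Definition _ := GRing.Lmodule.on regmod.

Definition lmove (i : 'I_n.-1) (p : label) : label :=
  (char_act (simple i) p.1, pcomp (simple i) p.2).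

(* Whether s_i shortens w while fixing chi, for p = (chi, w), a = i and b = i + 1. *)
Definition inverted (p : label) (a b : 'I_n) : bool :=
  (p.1 a == p.1 b) && (p.2^-1%g b < p.2^-1%g a)%N.

(* The regular representation in coordinates: F is the coefficient function of a
   combination of the elements E_chi g_w / u ^ ell w, which are not yet known to
   be independent. *)
Definition reg_gen (x : ygen n) (F : regmod) : regmod :=
  match x with
  | gen_g i => [ffun p : label => u * F (lmove i p) + v * (inverted p (lo i) (hi i))%:R * F p]
  | gen_t j => [ffun p : label => lcst (xi (p.1 j)) * F p]
  end.

Arguments reg_gen : simpl never.

Lemma reg_gE i F p : reg_gen (gen_g i) F p =
  u * (F (lmove i p) : A) + v * (inverted p (lo i) (hi i))%:R * (F p : A).
Proof. exact: ffunE. Qed.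

Lemma reg_tE j F p : reg_gen (gen_t j) F p = lcst (xi (p.1 j)) * (F p : A).
Proof. exact: ffunE. Qed.

Lemma reg_linE (a : A) (F G : regmod) p : (a *: F + G) p = a * (F p : A) + (G p : A) :> A.
Proof. by rewrite !ffunE. Qed.

Lemma reg_gen_linear x : linear (reg_gen x).
Proof.
move=> a F G; apply/ffunP => p; apply: (etrans _ (esym (reg_linE _ _ _ _))).
by case: x => [i|j]; rewrite ?reg_gE ?reg_tE !reg_linE; ring.
Qed.

Local Notation act := (@tact A (yok_pres C d n) regmod reg_gen).

Lemma inverted_lmove i p a b :
  inverted (lmove i p) a b = inverted p (simple i a) (simple i b).
Proof. by rewrite /inverted /lmove /= !char_actE simpleV !pcompV_simple. Qed.

Lemma lmoveK i : involutive (lmove i).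
Proof.
case=> chi w; rewrite /lmove /= -char_actM pcomp_simpleK; congr pair.
by apply/ffunP => a; rewrite char_actE invgpcomp pcompE !simpleV simpleK.
Qed.

Lemma lmove_comm (i j : 'I_n.-1) p : (i.+1 < j)%N -> lmove i (lmove j p) = lmove j (lmove i p).
Proof.
move=> H; rewrite /lmove /= -!char_actM (pcomp_comm _ H); congr (char_act _ _, _).
by have := pcomp_comm 1%g H; rewrite !pcompw1.
Qed.

Lemma lmove_braid (i j : 'I_n.-1) p : j = i.+1 :> nat ->
  lmove i (lmove j (lmove i p)) = lmove j (lmove i (lmove j p)).
Proof.
move=> H; rewrite /lmove /= -!char_actM (pcomp_braid _ H); congr (char_act _ _, _).
by have := pcomp_braid 1%g H; rewrite !pcompw1 !pcompA.
Qed.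

Lemma act_tX j k F p : act (Gen (gen_t j) ^+ k)%PT F p = lcst (xi (p.1 j) ^+ k) * (F p : A).
Proof.
elim: k => [|k IH] /=; first by rewrite scale1r expr0 rmorph1 mul1r.
by rewrite [LHS]reg_tE IH exprS rmorphM mulrA.
Qed.

Lemma act_e i F p :
  act (term_e C d i) F p = (p.1 (lo i) == p.1 (hi i))%:R * (F p : A).
Proof.
have d0 : d != 0%N by case: d (p.1 (lo i)) => [[]|].
rewrite /= tact_sum.
have -> (x : A) (G : regmod) : (x *: G) p = x * (G p : A) by rewrite ffunE.
rewrite sum_ffunE /=.
rewrite (eq_bigr (fun s : 'I_d =>
    lcst (xi (p.1 (lo i)) ^+ s * xi (p.1 (hi i)) ^+ (d - s)) * (F p : A))); last first.
  by move=> s _; rewrite [tact _ _ _]/= act_tX act_tX mulrA rmorphM.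
rewrite -mulr_suml mulrA -rmorph_sum -rmorphM root_sum.
case: eqP => _; last by rewrite mulr0 rmorph0.
by rewrite mulVf ?pnatr_eq0 // rmorph1.
Qed.

(* The coefficients at s_i p and s_j p on the two sides of the braid relation. *)
Lemma inverted_braid p (a b c : 'I_n) : a != b -> b != c -> a != c ->
  (inverted p a c * inverted p b a + inverted p a b * inverted p b c =
   inverted p b c * inverted p a c)%N /\
  (inverted p a b * inverted p a c =
   inverted p a c * inverted p c b + inverted p b c * inverted p a b)%N.
Proof.
case: p => chi w ab bc ac; rewrite /inverted /=.
have inj x y : x != y -> (w^-1%g x != w^-1%g y :> nat)%N.
  by rewrite val_eqE (inj_eq perm_inj).
move: (inj _ _ ab) (inj _ _ bc) (inj _ _ ac).
have [Eab|] := eqVneq (chi a) (chi b); have [Ebc|] := eqVneq (chi b) (chi c);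
  have [Eac|] := eqVneq (chi a) (chi c);
  rewrite ?[chi b == chi a]eq_sym ?[chi c == chi b]eq_sym ?Eab ?Ebc ?Eac ?eqxx //=.
all: try lia.
by rewrite -Eab Eac eqxx.
Qed.

Lemma reg_comm (i j : 'I_n.-1) F : (i.+1 < j)%N ->
  reg_gen (gen_g i) (reg_gen (gen_g j) F) = reg_gen (gen_g j) (reg_gen (gen_g i) F).
Proof.
move=> ij; have [lj hj li hi'] := simple_far ij; apply/ffunP => p.
rewrite !reg_gE !inverted_lmove (lmove_comm _ ij) lj hj li hi'; ring.
Qed.

Lemma reg_braid (i j : 'I_n.-1) F : j = i.+1 :> nat ->
  reg_gen (gen_g i) (reg_gen (gen_g j) (reg_gen (gen_g i) F)) =
  reg_gen (gen_g j) (reg_gen (gen_g i) (reg_gen (gen_g j) F)).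
Proof.
move=> ij; have [lj si sj] := simple_next ij; apply/ffunP => p.
have ab := lo_hi i; have bc := lo_hi j.
have ac : lo i != hi j by rewrite -val_eqE /= ij; lia.
have sh : simple j (hi i) = hi j by rewrite -lj simple_lo.
rewrite lj in bc.
rewrite !reg_gE !inverted_lmove !lmoveK (lmove_braid _ ij) lj.
rewrite !(simple_lo, simple_hi, si, sj, sh, lj).
have [] := inverted_braid p ab bc ac.
do 5!case: (inverted p _ _) => /=; move=> // _ _; ring.
Qed.

(** When $s_i$ fixes the character of $p$, exactly one of $p$ and [lmove i p] is inverted, otherwise
    neither. So the two cross terms add up to the factor by which $e_i$ acts. *)
Lemma reg_quad i F : reg_gen (gen_g i) (reg_gen (gen_g i) F) =
  u ^+ 2 *: F + v *: act (term_e C d i) (reg_gen (gen_g i) F).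
Proof.
apply/ffunP => p; have -> (x y : A) (G H : regmod) :
  (x *: G + y *: H) p = x * (G p : A) + y * (H p : A) by rewrite !ffunE.
rewrite act_e !reg_gE inverted_lmove simple_lo simple_hi lmoveK.
rewrite /inverted [p.1 (hi i) == _]eq_sym.
have -> : (p.2^-1%g (lo i) < p.2^-1%g (hi i))%N = ~~ (p.2^-1%g (hi i) < p.2^-1%g (lo i))%N.
  by rewrite -leqNgt [RHS]leq_eqVlt val_eqE (inj_eq perm_inj) (negPf (lo_hi i)).
by case: (_ == _); case: (_ < _)%N => /=; ring.
Qed.

Lemma reg_rel s t : prel (p := yok_pres C d n) s t -> act s =1 act t.
Proof.
case=> {s t} [i j ij|i j ij|i j|i j|j|i] F /=.
- by case/orP: ij => ij; rewrite (reg_comm _ ij).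
- exact: reg_braid.
- by apply/ffunP => p; rewrite !reg_tE; ring.
- apply/ffunP => p; rewrite !(reg_tE, reg_gE) /lmove /= char_actE simpleV /inverted.
  (* The diagonal term of $g_i$ survives only where $s_i$ fixes the character, and there $t_j$ and
     $t_{s_i(j)}$ have the same eigenvalue. *)
  case: (p.1 (lo i) =P p.1 (hi i)) => [E|_] /=; last by ring.
  have <- : p.1 (simple i j) = p.1 j; last by ring.
  have /eqP {2}<- : char_act (simple i) p.1 == p.1 by rewrite simple_fix E.
  by rewrite char_actE simpleV.
- by apply/ffunP => p; rewrite act_tX urootX rmorph1 mul1r scale1r.
- by rewrite reg_quad scale1r.
Qed.

End RegularModule.

(** * Normalized elements of the Hecke and Yokonuma-Hecke algebras *)

Section BraidAlgebra.
Context (C : numFieldType) (n : nat).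
Local Notation A := (laurent C).
Local Notation u := (lu C).
Local Notation v := (lv C).
Local Notation uV := (luV C).
Context (B : algType A) (f e : 'I_n.-1 -> B).
Hypothesis f_comm : forall i j : 'I_n.-1, (i.+1 < j)%N -> f i * f j = f j * f i.
Hypothesis f_braid : forall i j : 'I_n.-1,
  j = i.+1 :> nat -> f i * f j * f i = f j * f i * f j.
Hypothesis f_quad : forall i, f i * f i = (u ^+ 2)%:A + v *: (e i * f i).
Implicit Types (i : 'I_n.-1) (w : 'S_n) (s : seq 'I_n.-1).

(** One treatment serves both algebras: [e] is constantly $1$ for the Hecke algebra and is $e_i$ for
    the Yokonuma--Hecke algebra. *)
Definition tilde_gen i : B := uV *: f i.
Definition tilde_word s : B := \prod_(i <- s) tilde_gen i.
Definition tilde_elt w : B := uV ^+ ell w *: \prod_(i <- redword w) f i.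

Lemma tilde_wordE s : tilde_word s = uV ^+ size s *: \prod_(i <- s) f i.
Proof.
rewrite /tilde_word; elim: s => [|i s IH]; first by rewrite !big_nil expr0 scale1r.
by rewrite !big_cons IH /tilde_gen -scalerAl -scalerAr scalerA exprS.
Qed.

Lemma tilde_eltE w : tilde_elt w = tilde_word (redword w).
Proof. by rewrite tilde_wordE size_redword. Qed.

Lemma tilde_word_reduced s : reduced s -> tilde_word s = tilde_elt (word_perm s).
Proof.
move=> rs; rewrite tilde_wordE /tilde_elt (eqP rs); congr (_ *: _).
apply: (matsumoto f_comm f_braid rs (redword_reduced _)).
by rewrite redwordK.
Qed.

Lemma tilde_elt1 : tilde_elt 1%g = 1.
Proof. by rewrite -(tilde_word_reduced (s := [::])) /tilde_word ?big_nil // /reduced /= ell1. Qed.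

Lemma tilde_up i w : ~~ ldesc i w -> tilde_gen i * tilde_elt w = tilde_elt (pcomp (simple i) w).
Proof.
move=> Hi; have E : word_perm (i :: redword w) = pcomp (simple i) w by rewrite /= redwordK.
rewrite -E -tilde_word_reduced; last by rewrite /reduced E ell_up //= size_redword.
by rewrite /tilde_word big_cons tilde_eltE.
Qed.

Lemma tilde_upr i w : ~~ ldesc i w^-1%g ->
  tilde_elt w * tilde_gen i = tilde_elt (pcomp w (simple i)).
Proof.
move=> Hi; have E : word_perm (redword w ++ [:: i]) = pcomp w (simple i).
  by rewrite word_perm_cat redwordK /= pcompw1.
rewrite -E -tilde_word_reduced; last first.
  by rewrite /reduced E ell_upr // size_cat size_redword addn1.
by rewrite /tilde_word big_cat big_seq1 tilde_eltE.
Qed.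

Lemma tilde_gen_sq i : tilde_gen i * tilde_gen i = 1 + (uV * v) *: (e i * tilde_gen i).
Proof.
rewrite /tilde_gen -!scalerAl -!scalerAr f_quad !scalerDr !scalerA; congr (_ + _ *: _).
  have -> : uV * uV * u ^+ 2 = (u * uV) ^+ 2 by ring.
  by rewrite luK expr1n scale1r.
by ring.
Qed.

Lemma tilde_mul i w : tilde_gen i * tilde_elt w =
  tilde_elt (pcomp (simple i) w) + (uV * v * (ldesc i w)%:R) *: (e i * tilde_elt w).
Proof.
case: (boolP (ldesc i w)) => Hi; last by rewrite mulr0 scale0r addr0 tilde_up.
have Hi' : ~~ ldesc i (pcomp (simple i) w) by rewrite ldesc_simple negbK.
have E := tilde_up Hi'; rewrite pcomp_simpleK in E.
by rewrite -E !mulrA tilde_gen_sq mulrDl mul1r mulr1 -scalerAl.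
Qed.

(** [e i] stays next to the last generator, since it need not commute with [tilde_elt]; there it can
    meet an idempotent multiplied on the right. *)
Lemma tilde_mulr i w : tilde_elt w * tilde_gen i = tilde_elt (pcomp w (simple i)) +
  (uV * v * (ldesc i w^-1%g)%:R) *:
    (tilde_elt (pcomp w (simple i)) * (e i * tilde_gen i)).
Proof.
case: (boolP (ldesc i w^-1%g)) => Hi; last by rewrite mulr0 scale0r addr0 tilde_upr.
have Hi' : ~~ ldesc i (pcomp w (simple i))^-1%g.
  by rewrite invgpcomp simpleV ldesc_simple negbK.
have E := tilde_upr Hi'; rewrite pcomp_simpleKr in E.
by rewrite -E -!mulrA tilde_gen_sq mulrDr !mulr1 -scalerAr.
Qed.

End BraidAlgebra.

Section YokonumaElements.
Context (C : numFieldType) (d n : nat) (xi : unity_roots C d).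
Local Notation A := (laurent C).
Local Notation u := (lu C).
Local Notation v := (lv C).
Local Notation uV := (luV C).
Local Notation Y := (yokonuma C d n).
Implicit Types (i j : 'I_n.-1) (w x : 'S_n) (s : seq 'I_n.-1) (chi : tchar d n).

Definition gene i : Y := teval (pelt (yok_pres C d n)) (term_e C d i).

Lemma geng_comm i j : (i.+1 < j)%N -> geng C d i * geng C d j = geng C d j * geng C d i.
Proof.
move=> ij; have ij' : (i.+1 < j)%N || (j.+1 < i)%N by rewrite ij.
exact: (palg_rel (P := yok_pres C d n) (yok_comm C d ij')).
Qed.

Lemma geng_braid i j : j = i.+1 :> nat ->
  geng C d i * geng C d j * geng C d i = geng C d j * geng C d i * geng C d j.
Proof. by move=> ij; exact: (palg_rel (P := yok_pres C d n) (yok_braid C d ij)). Qed.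

Lemma geng_quad i : geng C d i * geng C d i = (u ^+ 2)%:A + v *: (gene i * geng C d i).
Proof.
have := palg_rel (P := yok_pres C d n) (yok_quad C d i).
by rewrite /gene /= scale1r mulr1 -!scalerAl mul1r => ->; rewrite -!scalerAl.
Qed.

Lemma geneE i : gene i =
  lcst (d%:R^-1) *: \sum_(s < d) gent C d (lo i) ^+ s * gent C d (hi i) ^+ (d - s).
Proof.
rewrite /gene /= teval_sum -scalerAl mul1r; congr (_ *: _).
by apply: eq_bigr => s _ /=; rewrite !teval_iter.
Qed.

(** Each $t_j$ acts on $E_\chi$ by $\chi(t_j)$, so $e_i$ acts by the average of the powers of
    $\chi(t_i)/\chi(t_{i+1})$, which orthogonality of the roots evaluates. *)
Lemma gene_Echi i chi :
  gene i * Echi xi chi = (chi (lo i) == chi (hi i))%:R *: Echi xi chi.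
Proof.
have tX (j : 'I_n) k : gent C d j ^+ k * Echi xi chi = lcst (xi (chi j) ^+ k) *: Echi xi chi.
  elim: k => [|k IH]; first by rewrite !expr0 mul1r rmorph1 scale1r.
  by rewrite exprSr -mulrA gent_Echi -scalerAr IH scalerA -rmorphM exprS.
rewrite geneE -scalerAl mulr_suml.
rewrite (eq_bigr (fun s : 'I_d =>
    lcst (xi (chi (lo i)) ^+ s * xi (chi (hi i)) ^+ (d - s)) *: Echi xi chi)); last first.
  by move=> s _; rewrite -mulrA tX -scalerAr tX scalerA -rmorphM mulrC.
rewrite -scaler_suml scalerA -rmorph_sum -rmorphM root_sum.
case: eqP => _; last by rewrite mulr0 rmorph0.
rewrite mulVf ?rmorph1 // pnatr_eq0 -lt0n.
exact: leq_ltn_trans (leq0n _) (ltn_ord (chi (lo i))).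
Qed.

Lemma gene_Echi_comm i chi : GRing.comm (gene i) (Echi xi chi).
Proof.
rewrite geneE; apply/commr_sym/commZ/commr_sum => s _.
have E k : GRing.comm (Echi xi chi) (gent C d k).
  by apply: commr_sym; apply: (@commr_prodE1 _ _ _ _ _ _ id) => a; apply: gent_comm.
by apply: commrM; apply: commrX.
Qed.

Local Notation tg := (tilde_gen (C := C) (@geng C d n)).
Local Notation tgw := (tilde_word (C := C) (@geng C d n)).

Lemma tildegE w : tildeg C d w = tilde_elt (C := C) (@geng C d n) w.
Proof. by []. Qed.

Lemma tilde_geng_Echi i chi : tg i * Echi xi chi = Echi xi (char_act (simple i) chi) * tg i.
Proof. by rewrite /tilde_gen -scalerAl geng_Echi -scalerAr. Qed.

Lemma tilde_word_Echi s chi :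
  tgw s * Echi xi chi = Echi xi (char_act (word_perm s) chi) * tgw s.
Proof.
rewrite /tilde_word; elim: s => [|i s IH].
  by rewrite !big_nil char_act1 mulr1 mul1r.
by rewrite !big_cons -mulrA IH mulrA tilde_geng_Echi -mulrA char_actM.
Qed.

Lemma tildeg_Echi w chi :
  tildeg C d w * Echi xi chi = Echi xi (char_act w chi) * tildeg C d w.
Proof. by rewrite tildegE tilde_eltE tilde_word_Echi redwordK. Qed.

Fixpoint moving s chi : bool :=
  if s is i :: s' then
    moving s' chi &&
    (char_act (simple i) (char_act (word_perm s') chi) != char_act (word_perm s') chi)
  else true.

Lemma moving_cat s t chi :
  moving (s ++ t) chi = moving s (char_act (word_perm t) chi) && moving t chi.
Proof.
by elim: s => //= i s ->; rewrite word_perm_cat char_actM andbAC.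
Qed.

(** The reversed word retraces the same path of characters backwards. *)
Lemma moving_rev s chi : moving s chi -> moving (rev s) (char_act (word_perm s) chi).
Proof.
elim: s => //= i s IH /andP [/IH H1 H2].
rewrite rev_cons -cats1 moving_cat /= pcompw1 char_act1 -!char_actM pcomp_simpleK H1 /=.
by rewrite eq_sym char_actM.
Qed.

Lemma tildeg_mul i w : tg i * tildeg C d w = tildeg C d (pcomp (simple i) w) +
  (uV * v * (ldesc i w)%:R) *: (gene i * tildeg C d w).
Proof. exact: (tilde_mul geng_comm geng_braid geng_quad). Qed.

Lemma tildeg_mulr i w : tildeg C d w * tg i = tildeg C d (pcomp w (simple i)) +
  (uV * v * (ldesc i w^-1%g)%:R) *: (tildeg C d (pcomp w (simple i)) * (gene i * tg i)).
Proof. exact: (tilde_mulr geng_comm geng_braid geng_quad). Qed.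

(* The quadratic relation loses its linear term on a character that s_i moves. *)
Lemma moving_left s x chi : moving s (char_act x chi) ->
  tgw s * tildeg C d x * Echi xi chi = tildeg C d (pcomp (word_perm s) x) * Echi xi chi.
Proof.
rewrite /tilde_word; elim: s => [_|i s IH] /=; first by rewrite big_nil mul1r pcomp1w.
case/andP => /IH E; rewrite simple_fix -!char_actM => H.
rewrite big_cons -!mulrA [X in _ * X]mulrA E mulrA.
rewrite tildeg_mul mulrDl -(scalerAl _ (gene i * _)) -(mulrA (gene i)) pcompA.
by rewrite [X in gene i * X]tildeg_Echi mulrA gene_Echi (negPf H) scale0r mul0r scaler0 addr0.
Qed.

Lemma moving_right s x chi : moving s chi ->
  tildeg C d x * tgw s * Echi xi chi = tildeg C d (pcomp x (word_perm s)) * Echi xi chi.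
Proof.
rewrite /tilde_word; elim: s x => [|i s IH] x /=; first by rewrite big_nil mulr1 pcompw1.
case/andP => Hs; rewrite simple_fix.
set psi := char_act (word_perm s) chi => H.
(* In the error term $\tilde g_i$ carries $E_\psi$ to $E_{s_i(\psi)}$ before $e_i$ acts. The values
   of $\psi$ at $i$ and $i+1$ are only exchanged, so $e_i$ kills this idempotent too. *)
have {}H : (char_act (simple i) psi (lo i) == char_act (simple i) psi (hi i)) = false.
  by rewrite !(char_actE (simple i) psi) simpleV simple_lo simple_hi eq_sym (negPf H).
have Es : tgw s * Echi xi chi = Echi xi psi * tgw s.
  exact: tilde_word_Echi.
rewrite pcompA -IH // big_cons mulrA -!mulrA -/(tgw s) Es !mulrA; congr (_ * _).
rewrite tildeg_mulr mulrDl -(scalerAl _ (tildeg C d _ * (gene i * _))) -!(mulrA _ _ (Echi _ _)).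
by rewrite tilde_geng_Echi [gene i * _]mulrA gene_Echi H scale0r mul0r mulr0 scaler0 addr0.
Qed.

End YokonumaElements.

(* The matrices of root_sum are inverse to each other up to the factor d; this is
   the product in the other order. *)
Lemma root_power_sum (C : numFieldType) d (xi : unity_roots C d) (s : 'I_d) :
  \sum_a xi a ^+ s = if s == 0%N :> nat then d%:R else 0.
Proof.
have d_gt0 : (0 < d)%N by apply: leq_ltn_trans (ltn_ord s).
have d0 : d%:R != 0 :> C by rewrite pnatr_eq0 -lt0n.
pose F : 'M[C]_d := \matrix_(b, s) xi b ^+ s.
pose G : 'M[C]_d := \matrix_(s, a) (d%:R^-1 * xi a ^+ (d - s)).
have FG : F *m G = 1%:M.
  apply/matrixP => b a; rewrite !mxE.
  under eq_bigr do rewrite !mxE mulrCA.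
  rewrite -mulr_sumr root_sum; case: eqP => _; rewrite ?mulr0 ?mulVf //.
(* Row $0$ of $GF=1$ is the claim up to the factor $d^{-1}$, because the entries of $G$ in that row
   contain $\xi_a^d=1$. *)
have /matrixP /(_ (Ordinal d_gt0) s) := mulmx1C FG.
rewrite !mxE; under eq_bigr do rewrite !mxE subn0 urootX mulr1.
rewrite -mulr_sumr -val_eqE /= eq_sym => E; apply: (mulfI (invr_neq0 d0)).
by rewrite E; case: eqP => _; rewrite ?mulr0 ?mulVf.
Qed.

(** * A basis of the Yokonuma--Hecke algebra *)

Section YokonumaBasis.
Context (C : numFieldType) (d n : nat) (xi : unity_roots C d).
Hypothesis d_gt0 : (0 < d)%N.
Local Notation A := (laurent C).
Local Notation u := (lu C).
Local Notation v := (lv C).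
Local Notation uV := (luV C).
Local Notation Y := (yokonuma C d n).
Local Notation tg := (tilde_gen (C := C) (@geng C d n)).
Local Notation label := (label d n).
Implicit Types (i : 'I_n.-1) (w x : 'S_n) (chi : tchar d n) (p : label) (y : Y).

Lemma E1_sum (j : 'I_n) : \sum_a E1 xi j a = 1.
Proof.
rewrite -scaler_sumr exchange_big /=.
under eq_bigr => s _ do rewrite -scaler_suml -rmorph_sum root_power_sum.
rewrite (bigD1 (Ordinal d_gt0)) //= subn0 gentX big1 ?addr0.
  by rewrite scalerA -rmorphM mulVf ?rmorph1 ?scale1r // pnatr_eq0 -lt0n.
by move=> s; rewrite -val_eqE /= => /negPf ->; rewrite rmorph0 scale0r.
Qed.

Lemma Echi_sum : \sum_chi Echi xi chi = 1 :> Y.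
Proof.
rewrite /Echi -(bigA_distr_bigA (fun j a => E1 xi j a)) big1 // => j _; exact: E1_sum.
Qed.

Definition ybasis p : Y := Echi xi p.1 * tildeg C d p.2.

(** This is the origin of [reg_gen]: multiplied by $u$ and transposed to coefficient functions, it
    is the formula for the action of $g_i$. *)
Lemma tilde_gen_ybasis i p : tg i * ybasis p =
  ybasis (lmove i p) + (uV * v * (inverted p (lo i) (hi i))%:R) *: ybasis p.
Proof.
rewrite /ybasis mulrA tilde_geng_Echi -[LHS]mulrA  tildeg_mul mulrDr; congr (_ + _).
rewrite -scalerAr mulrA -gene_Echi_comm gene_Echi -scalerAl scalerA.
have -> : (char_act (simple i) p.1 (lo i) == char_act (simple i) p.1 (hi i)) =
          (p.1 (lo i) == p.1 (hi i)).
  by rewrite !char_actE simpleV simple_lo simple_hi eq_sym.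
rewrite /inverted -/(ldesc i p.2) -simple_fix.
by case: eqP => [->|_]; case: ldesc; rewrite ?(mulr0, mul0r, mulr1, scale0r).
Qed.

(** The span is stable under left multiplication by the generators and contains $1=\sum_\chi
    E_\chi\tilde g_1$. *)
Lemma ybasis_span y : exists c : {ffun label -> A}, y = \sum_p c p *: ybasis p.
Proof.
pose S (z : Y) := exists c : {ffun label -> A}, z = \sum_p c p *: ybasis p.
have S0 : S 0 by exists [ffun=> 0]; rewrite big1 // => p _; rewrite ffunE scale0r.
have SD (x z : Y) : S x -> S z -> S (x + z).
  move=> [c ->] [e ->]; exists [ffun p => c p + e p].
  by rewrite -big_split; apply: eq_bigr => p _; rewrite ffunE scalerDl.
have SZ a (z : Y) : S z -> S (a *: z).
  move=> [c ->]; exists [ffun p => a * c p].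
  by rewrite scaler_sumr; apply: eq_bigr => p _; rewrite ffunE scalerA.
have Ssum I (r : seq I) (F : I -> Y) : (forall k, S (F k)) -> S (\sum_(k <- r) F k).
  by move=> H; elim/big_rec: _ => // k z _; apply: SD.
have Sb p : S (ybasis p).
  exists [ffun q => (q == p)%:R].
  rewrite (bigD1 p) //= ffunE eqxx scale1r big1 ?addr0 // => q /negPf H.
  by rewrite ffunE H scale0r.
have SM (z : Y) : forall x : Y, S x -> S (z * x).
  elim/pclassW: z => t; rewrite pclassE.
  elim: t => [a|g|s IHs t IHt|s IHs t IHt] x0 Sx /=.
  - by rewrite -scalerAl mul1r; apply/SZ.
  - case: Sx => c ->; rewrite mulr_sumr; apply: Ssum => p; rewrite -scalerAr; apply/SZ.
    case: g => [i|j].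
      rewrite -/(geng C d i) (_ : geng C d i = u *: tg i).
        by rewrite -scalerAl tilde_gen_ybasis; apply/SZ; apply/SD => //; apply/SZ.
      by rewrite scalerA luK scale1r.
    by rewrite -/(gent C d j) /ybasis mulrA gent_Echi -scalerAl; apply/SZ/Sb.
  - by rewrite mulrDl; apply: SD; [apply: IHs | apply: IHt].
  - by rewrite -mulrA; apply/IHs/IHt.
rewrite -[y]mulr1 -Echi_sum; apply/SM/Ssum => chi.
rewrite (_ : Echi xi chi = ybasis (chi, 1%g)) //.
by rewrite /ybasis tildegE tilde_elt1 ?mulr1 //; [apply: geng_comm | apply: geng_braid].
Qed.

Local Notation yact := (@pact A (yok_pres C d n) (regmod C d n) (reg_gen xi)).
Let reg_lin : forall g : pgen (yok_pres C d n), linear (reg_gen xi g) :=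
  @reg_gen_linear C d n xi.
Let reg_ok := @reg_rel C d n xi.

Lemma yact_lin F p (a : A) (x y : Y) :
  yact (a *: x + y) F p = a * (yact x F p : A) + (yact y F p : A) :> A.
Proof. by rewrite (pact_linear_l reg_lin reg_ok) reg_linE. Qed.

Lemma yactZ F p (a : A) y : yact (a *: y) F p = a * (yact y F p : A) :> A.
Proof.
have y0 : yact 0 F p = 0 :> A.
  by have := yact_lin F p (-1) 0 0; rewrite scaleN1r addNr mulN1r addNr.
by rewrite -[a *: y]addr0 yact_lin y0 addr0.
Qed.

Lemma yact_sum F p I (r : seq I) (G : I -> Y) :
  yact (\sum_(k <- r) G k) F p = \sum_(k <- r) (yact (G k) F p : A) :> A.
Proof.
elim: r => [|k r IH].
  by rewrite !big_nil -(scale0r (0 : Y)) yactZ mul0r.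
by rewrite !big_cons -[G k]scale1r yact_lin IH mul1r scale1r.
Qed.

Lemma yact_gent j k F p : yact (gent C d j ^+ k) F p = lcst (xi (p.1 j) ^+ k) * (F p : A) :> A.
Proof.
elim: k => [|k IH]; first by rewrite !expr0 (pact1 reg_lin reg_ok) rmorph1 mul1r.
by rewrite exprS (pactM reg_lin reg_ok) (pact_gen reg_lin reg_ok) reg_tE IH exprS rmorphM mulrA.
Qed.

Lemma yact_E1 j a F p : yact (E1 xi j a) F p = (p.1 j == a)%:R * (F p : A) :> A.
Proof.
rewrite yactZ yact_sum.
under eq_bigr => s _ do rewrite yactZ yact_gent mulrA -rmorphM.
rewrite -mulr_suml mulrA -rmorph_sum -rmorphM root_sum eq_sym.
by case: eqP => _; rewrite ?mulr0 ?rmorph0 // mulVf ?rmorph1 // pnatr_eq0 -lt0n.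
Qed.

Lemma yact_Echi chi F p : yact (Echi xi chi) F p = (p.1 == chi)%:R * (F p : A) :> A.
Proof.
have H (r : seq 'I_n) : yact (\prod_(j <- r) E1 xi j (chi j)) F p =
    (all (fun j => p.1 j == chi j) r)%:R * (F p : A) :> A.
  elim: r => [|j r IH] /=; first by rewrite big_nil (pact1 reg_lin reg_ok) mul1r.
  by rewrite big_cons (pactM reg_lin reg_ok) yact_E1 IH mulrA -natrM mulnb.
rewrite /Echi H; congr (_%:R * _); congr nat_of_bool.
apply/allP/eqP => [E|-> //]; apply/ffunP => j; apply/eqP/E; exact: mem_index_enum.
Qed.

Lemma yact_tildeg w p : yact (tildeg C d w) [ffun q : label => (q.2 == 1%g)%:R] p =
  (p.2 == w)%:R :> A.
Proof.
rewrite tildegE tilde_eltE -{2}(redwordK w); move: (redword_reduced w).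
elim: (redword w) p => [|i s IH] p rs.
  by rewrite /tilde_word big_nil (pact1 reg_lin reg_ok) ffunE.
have [rs' Hi] := reduced_cons rs.
rewrite /tilde_word big_cons (pactM reg_lin reg_ok) -/(tilde_word _ s) yactZ.
rewrite (pact_gen reg_lin reg_ok) reg_gE !IH //= mulrDr mulrA [uV * u]mulrC luK mul1r.
rewrite (can2_eq (pcomp_simpleK i) (pcomp_simpleK i)).
have [Ep|_] := eqVneq p.2 (word_perm s); last by rewrite !mulr0 addr0.
(* At the only label where the tail contributes, reducedness says that $s_i$ lengthens the
   permutation, so $g_i$ has no diagonal term there. *)
have -> : inverted p (lo i) (hi i) = false.
  by move: Hi; rewrite /= ldesc_simple /inverted Ep /ldesc => /negPf ->; rewrite andbF.
by rewrite mulr0 mul0r mulr0 addr0.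
Qed.

(** The vector acted on is the coefficient function of $\sum_\chi E_\chi=1$, so this reads off the
    coefficients of $y\cdot1$. *)
Definition coord y p : A := yact y [ffun q : label => (q.2 == 1%g)%:R] p.

Lemma coord_ybasis p q : coord (ybasis p) q = (q == p)%:R.
Proof.
rewrite /coord /ybasis (pactM reg_lin reg_ok) yact_Echi yact_tildeg -natrM mulnb.
by case: p q => [chi w] [psi x]; rewrite xpair_eqE.
Qed.

Lemma coord_linear p : scalar (coord^~ p).
Proof. by move=> a x y; rewrite /coord yact_lin. Qed.

Lemma coordE y : y = \sum_p coord y p *: ybasis p.
Proof.
have [c ->] := ybasis_span y; apply: eq_bigr => p _; congr (_ *: _).
rewrite /coord yact_sum (bigD1 p) //= yactZ -/(coord _ _) coord_ybasis eqxx mulr1.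
rewrite big1 ?addr0 // => q /negPf H.
by rewrite yactZ -/(coord _ _) coord_ybasis eq_sym H mulr0.
Qed.

End YokonumaBasis.

(** * Bases of the Hecke algebra and of its Young subalgebras *)

Section HeckeBasis.
Context (C : numFieldType) (n : nat).
Local Notation A := (laurent C).
Local Notation u := (lu C).
Local Notation v := (lv C).
Local Notation uV := (luV C).
Local Notation H := (hecke C n).
Local Notation tT := (tilde_gen (C := C) (@genT C n)).
Implicit Types (i j : 'I_n.-1) (w x : 'S_n).

Lemma genT_comm i j : (i.+1 < j)%N -> genT C i * genT C j = genT C j * genT C i.
Proof.
move=> ij; have ij' : (i.+1 < j)%N || (j.+1 < i)%N by rewrite ij.
exact: (palg_rel (P := hecke_pres C n) (hecke_comm C ij')).
Qed.

Lemma genT_braid i j : j = i.+1 :> nat ->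
  genT C i * genT C j * genT C i = genT C j * genT C i * genT C j.
Proof. by move=> ij; exact: (palg_rel (P := hecke_pres C n) (hecke_braid C ij)). Qed.

Lemma genT_quad i : genT C i * genT C i = (u ^+ 2)%:A + v *: (1 * genT C i).
Proof.
have := palg_rel (P := hecke_pres C n) (hecke_quad C i).
by rewrite /= scale1r mulr1 -!scalerAl.
Qed.

Lemma tildeT_mul i w : tT i * tildeT C w = tildeT C (pcomp (simple i) w) +
  (uV * v * (ldesc i w)%:R) *: tildeT C w.
Proof. by rewrite (tilde_mul genT_comm genT_braid genT_quad) mul1r. Qed.

Lemma tildeT1 : tildeT C 1%g = 1 :> H.
Proof. exact: (tilde_elt1 genT_comm genT_braid). Qed.

Lemma tildeT_simple i : tildeT C (simple i) = tT i.
Proof.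
rewrite -[RHS]mulr1 -tildeT1 (tilde_up genT_comm genT_braid) ?pcompw1 //.
by rewrite /ldesc invg1 !perm1 /= -leqNgt.
Qed.

Lemma genT_tilde i : genT C i = u *: tT i.
Proof. by rewrite scalerA luK scale1r. Qed.

Definition trivial_roots : unity_roots C 1 :=
  @UnityRoots C 1 (fun=> 1) (fun a b _ => etrans (ord1 a) (esym (ord1 b)))
    (fun=> expr1n C 1).

(* The Hecke algebra maps to the Yokonuma-Hecke algebra for d = 1, where e_i = 1. *)
Lemma hecke_coord_ex : exists cf : 'S_n -> H -> A,
  (forall w, scalar (cf w)) /\ (forall w x, cf w (tildeT C x) = (w == x)%:R).
Proof.
pose f i : yokonuma C 1 n := geng C 1 i.
have [|h [h_lin [h1 hM] hf _]] := @palg_universal A (hecke_pres C n) _ f.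
  move=> s t; case=> {s t} [i j ij|i j ij|i] /=.
  - by case/orP: ij => ij; rewrite /f (geng_comm _ _ ij).
  - exact: geng_braid.
  - rewrite scale1r mulr1 /f geng_quad geneE big_ord1 expr0 mul1r gentX.
    by rewrite invr1 rmorph1 scale1r mul1r -scalerAl mul1r.
have hZ a (x : H) : h (a *: x) = a *: h x.
  have h0 : h 0 = 0.
    by have := h_lin (-1) 0 0; rewrite scaleN1r addNr scaleN1r addNr.
  by rewrite -[a *: x]addr0 h_lin h0 addr0.
have hT w : h (tildeT C w) = tildeg C 1 w.
  rewrite /tildeT hZ /Tw /tildeg /gw; congr (_ *: _).
  by elim: (redword w) => [|i s IH]; rewrite ?big_nil ?big_cons // hM IH hf.
pose chi0 : tchar 1 n := [ffun=> ord0].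
exists (fun w (z : H) => coord trivial_roots (h z) (chi0, w)); split=> [w a x y|w x].
  by rewrite h_lin coord_linear.
have chi0E (chi : tchar 1 n) : chi = chi0 by apply/ffunP => j; rewrite [LHS]ord1 ffunE.
rewrite hT -[tildeg _ _ _]mul1r -(Echi_sum _ trivial_roots) //.
rewrite (bigD1 chi0) //= big1 ?addr0 => [|chi]; last by rewrite (chi0E chi) eqxx.
by rewrite -[Echi _ _ * _]/(ybasis trivial_roots (chi0, x)) coord_ybasis // xpair_eqE eqxx.
Qed.

Definition coordH : 'S_n -> H -> A := sval (cid hecke_coord_ex).

Lemma coordH_linear w : scalar (coordH w).
Proof. exact: (svalP (cid hecke_coord_ex)).1. Qed.

Lemma coordH_tildeT w x : coordH w (tildeT C x) = (w == x)%:R.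
Proof. exact: (svalP (cid hecke_coord_ex)).2. Qed.

HB.instance Definition _ w := GRing.isLinear.Build A H A *%R (coordH w) (coordH_linear w).

End HeckeBasis.

Section YoungHeckeBasis.
Context (C : numFieldType) (d n : nat) (mu : Comp d n).
Local Notation A := (laurent C).
Local Notation H := (hecke C n).
Implicit Types (i j : 'I_n.-1) (w x : 'S_n).

Lemma tildeT_Hmu w : w \in Young mu -> tildeT C w \in @in_Hmu C d n mu.
Proof.
elim/Young_ind => [|i {}w iY _ Hi IH]; first by rewrite tildeT1 rpred1.
rewrite -[tildeT C _](tilde_up (@genT_comm C n) (@genT_braid C n) Hi).
apply: rpredM => //; apply: rpredZ; apply/asboolP; apply: subalg_gen; by exists i.
Qed.

(** Made total in [w] by the default $0$; it is evaluated only on the Young subgroup. *)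
Definition HmuT w : Hmu C mu := insubd 0 (tildeT C w).

Lemma hval_HmuT w : w \in Young mu -> hval (HmuT w) = tildeT C w.
Proof. by move=> wY; apply: insubdK; apply: tildeT_Hmu. Qed.

(** The span of the $\tilde T_w$ with $w\in\mathfrak S^\mu$ contains $1$ and is stable under the
    generators of $\mathcal H^\mu$. Its coefficients are read off by coordinates of the whole of
    $\mathcal H_n$. *)
Lemma Hmu_span (y : H) : in_Hmu mu y ->
  y = \sum_(w in Young mu) coordH w y *: tildeT C w.
Proof.
pose S (z : H) := exists c : {ffun 'S_n -> A}, z = \sum_(w in Young mu) c w *: tildeT C w.
have SD (x z : H) : S x -> S z -> S (x + z).
  move=> [c ->] [e ->]; exists [ffun w => c w + e w].
  by rewrite -big_split; apply: eq_bigr => w _; rewrite ffunE scalerDl.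
have SZ a (z : H) : S z -> S (a *: z).
  move=> [c ->]; exists [ffun w => a * c w].
  by rewrite scaler_sumr; apply: eq_bigr => w _; rewrite ffunE scalerA.
have S0 : S 0 by exists [ffun=> 0]; rewrite big1 // => w _; rewrite ffunE scale0r.
have Sb w : w \in Young mu -> S (tildeT C w).
  move=> wY; exists [ffun x => (x == w)%:R].
  rewrite (bigD1 w) //= ffunE eqxx scale1r big1 ?addr0 // => x /andP [_ /negPf E].
  by rewrite ffunE E scale0r.
have SM (z : H) : subalg (fun y => exists2 i, simple i \in Young mu & y = genT C i) z ->
    forall x : H, S x -> S (z * x).
  elim=> {z} [z [i iY ->]|a|z t _ IHz _ IHt|z t _ IHz _ IHt] x Sx.
  - case: Sx => c ->; rewrite mulr_sumr; elim/big_rec: _ => // w y0 wY Sz.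
    apply: (SD _ _ _ Sz); rewrite -scalerAr; apply/SZ.
    rewrite genT_tilde -scalerAl tildeT_mul; apply/SZ/SD; first exact/Sb/YoungM.
    exact/SZ/Sb.
  - by rewrite -scalerAl mul1r; apply/SZ.
  - by rewrite mulrDl; apply/SD; [apply/IHz | apply/IHt].
  - by rewrite -mulrA; apply/IHz/IHt.
move=> /asboolP yH; have [c Ec] : S y.
  by rewrite -[y]mulr1; apply: (SM _ yH); rewrite -tildeT1; apply/Sb/Young1.
rewrite Ec; apply: eq_bigr => w wY; congr (_ *: _).
rewrite linear_sum (bigD1 w) //= linearZ /= coordH_tildeT eqxx mulr1.
rewrite big1 ?addr0 // => x /andP [_ /negPf E].
by rewrite linearZ /= coordH_tildeT eq_sym E mulr0.
Qed.

End YoungHeckeBasis.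

(** * The isomorphism *)

Section Isomorphism.
Context (C : numFieldType) (d n : nat) (xi : unity_roots C d).
Context (mu : Comp d n) (p : 'I_(multinom mu) -> 'S_n).
Hypothesis p_lab : labelling p.
Local Notation A := (laurent C).
Local Notation u := (lu C).
Local Notation v := (lv C).
Local Notation uV := (luV C).
Local Notation Y := (yokonuma C d n).
Local Notation H := (hecke C n).
Local Notation tg := (tilde_gen (C := C) (@geng C d n)).
Local Notation tgw := (tilde_word (C := C) (@geng C d n)).
Local Notation tT := (tilde_gen (C := C) (@genT C n)).
Local Notation Echi1 := (Echi xi (chi1 mu)).
Local Notation chip := (chik p).
Implicit Types (i : 'I_n.-1) (w : 'S_n) (k l : 'I_(multinom mu)).

Lemma tildeg_word s : reduced s -> tgw s = tildeg C d (word_perm s).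
Proof. exact: (tilde_word_reduced (@geng_comm C d n) (@geng_braid C d n)). Qed.

Lemma tildeg1 : tildeg C d 1%g = 1 :> Y.
Proof. exact: (tilde_elt1 (@geng_comm C d n) (@geng_braid C d n)). Qed.

(** Tails of the word are again minimal in their cosets. If the first letter $s_i$ fixed the
    character produced by the tail $w$, then $w^{-1}s_iw\in\mathfrak S^\mu$, and $w$ would be a
    shorter element of the coset of $s_iw$. *)
Lemma moving_minimal s : reduced s -> minimal_rep mu (word_perm s) -> moving s (chi1 mu).
Proof.
elim: s => //= i s IH rs Hm; have [rs' Hi] := reduced_cons rs.
have Ei := ell_down Hi; rewrite /= pcomp_simpleK in Ei.
apply/andP; split.
  apply: IH => // y yY; have := Hm y yY; rewrite Ei -pcompA.
  by have := ell_simple i (pcomp (word_perm s) y); case: ldesc => /=; lia.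
apply/negP => /eqP E.
have yY : pcomp (word_perm s)^-1%g (pcomp (simple i) (word_perm s)) \in Young mu.
  apply/YoungP; rewrite !char_actM E -char_actM.
  by rewrite (_ : pcomp _ _ = 1%g) ?char_act1 // /pcomp mulgV.
have := Hm _ yY; rewrite Ei -pcompA pcompVV pcomp_simpleK; lia.
Qed.

Lemma minimal_p k : minimal_rep mu (p k).
Proof. by apply/(lab_image p_lab); exists k. Qed.

Lemma moving_p k : moving (redword (p k)) (chi1 mu).
Proof. by apply: moving_minimal; rewrite ?redword_reduced // redwordK; apply: minimal_p. Qed.

Lemma moving_pV k : moving (rev (redword (p k))) (chip k).
Proof. by rewrite /chik -{2}(redwordK (p k)); apply/moving_rev/moving_p. Qed.

Lemma chik_inj : injective chip.
Proof.
move=> k l E; apply: (lab_inj p_lab).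
exact: (minimal_rep_inj (minimal_p k) (minimal_p l)).
Qed.

Lemma chikV k : char_act (p k)^-1%g (chip k) = chi1 mu.
Proof. exact: char_actK. Qed.

Lemma has_comp_chik k : has_comp mu (chip k).
Proof. by rewrite has_comp_act has_comp_chi1. Qed.

Lemma chik_onto chi : has_comp mu chi -> exists k, chip k = chi.
Proof.
move=> /has_comp_chi1_act [w <-]; have [x Hx <-] := minimal_rep_ex mu w.
by have [k Ek] := (lab_image p_lab x).2 Hx; exists k; rewrite /chik Ek.
Qed.

Lemma chik_act k w : exists l, char_act w (chip l) = chip k.
Proof.
have [|l El] := chik_onto (chi := char_act w^-1%g (chip k)).
  by rewrite has_comp_act has_comp_chik.
by exists l; rewrite El char_actKV.
Qed.

Lemma Emu_chik : Emu xi mu = \sum_k Echi xi (chip k).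
Proof.
rewrite /Emu -big_filter -[RHS](big_map chip predT (fun chi => Echi xi chi)).
apply: perm_big; apply: uniq_perm.
- by rewrite filter_uniq // index_enum_uniq.
- by rewrite (map_inj_uniq chik_inj) index_enum_uniq.
move=> chi; rewrite mem_filter mem_index_enum andbT.
apply/idP/mapP => [/chik_onto [k <-]|[k _ ->]]; last exact: has_comp_chik.
by exists k; rewrite ?mem_index_enum.
Qed.

Lemma Emu_Echi k : Emu xi mu * Echi xi (chip k) = Echi xi (chip k).
Proof.
rewrite Emu_chik mulr_suml (bigD1 k) //= EchiM eqxx big1 ?addr0 // => l lk.
by rewrite EchiM (inj_eq chik_inj) (negPf lk).
Qed.

Lemma Echi1_comm w : w \in Young mu -> GRing.comm (tildeg C d w) Echi1.
Proof. by move=> /YoungP E; rewrite /GRing.comm tildeg_Echi E. Qed.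

Lemma Echi1M : Echi1 * Echi1 = Echi1.
Proof. by rewrite EchiM eqxx. Qed.

(** Extended to all of $\mathcal H_n$ by dropping the $\tilde T_w$ with $w\notin\mathfrak S^\mu$,
    which makes it linear by construction; it is shown to be multiplicative on $\mathcal H^\mu$. *)
Definition phi (x : H) : Y := \sum_(w in Young mu) coordH w x *: (tildeg C d w * Echi1).

Lemma phi_linear : linear phi.
Proof.
move=> a x y; rewrite /phi scaler_sumr -big_split; apply: eq_bigr => w _ /=.
by rewrite linearP scalerDl -scalerA.
Qed.

HB.instance Definition _ := GRing.isLinear.Build A H Y *:%R phi phi_linear.

Lemma phi_linearD : {morph phi : x y / x + y}.
Proof. exact: linearD. Qed.

Lemma phi_linearZ a : {morph phi : x / a *: x}.
Proof. exact: linearZ. Qed.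

Lemma phi_linear_sum (I : Type) (r : seq I) (P : pred I) (F : I -> H) :
  phi (\sum_(k <- r | P k) F k) = \sum_(k <- r | P k) phi (F k).
Proof. exact: linear_sum. Qed.

Lemma phi_tildeT w : w \in Young mu -> phi (tildeT C w) = tildeg C d w * Echi1.
Proof.
move=> wY; rewrite /phi (bigD1 w) //= coordH_tildeT eqxx scale1r.
rewrite big1 ?addr0 // => x /andP [_ /negPf E].
by rewrite coordH_tildeT E scale0r.
Qed.

Lemma phi1 : phi 1 = Echi1.
Proof. by rewrite -(tildeT1 C n) phi_tildeT ?Young1 // tildeg1 mul1r. Qed.

Lemma Echi1_phi (x : H) : Echi1 * phi x = phi x.
Proof.
rewrite mulr_sumr; apply: eq_bigr => w wY.
by rewrite -scalerAr mulrA -(Echi1_comm wY) -mulrA Echi1M.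
Qed.

Lemma tildeg_simple i : tildeg C d (simple i) = tg i.
Proof.
rewrite -[RHS]mulr1 -tildeg1 (tilde_up (@geng_comm C d n) (@geng_braid C d n)) ?pcompw1 //.
by rewrite /ldesc invg1 !perm1 /= -leqNgt.
Qed.

Lemma phi_tilde_genM i w : simple i \in Young mu -> w \in Young mu ->
  phi (tT i * tildeT C w) = tg i * phi (tildeT C w).
Proof.
move=> iY wY; rewrite tildeT_mul phi_linearD (phi_linearZ (uV * v * _)) !phi_tildeT ?YoungM //.
rewrite mulrA tildeg_mul mulrDl -(scalerAl _ (gene _ _ _ * _)); congr (_ + _ *: _).
rewrite -mulrA (Echi1_comm wY) mulrA gene_Echi.
by move: iY; rewrite simple_Young => ->; rewrite scale1r.
Qed.

Lemma phi_genM i (y : H) : simple i \in Young mu -> in_Hmu mu y ->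
  phi (genT C i * y) = phi (genT C i) * phi y.
Proof.
move=> iY yS; have -> : phi (genT C i) = u *: (tg i * Echi1).
  by rewrite genT_tilde phi_linearZ -tildeT_simple phi_tildeT // tildeg_simple.
rewrite genT_tilde -(scalerAl _ (tT i)) -(scalerAl _ (tg i * _)) phi_linearZ -mulrA Echi1_phi.
congr (_ *: _).
rewrite (Hmu_span yS) mulr_sumr !phi_linear_sum mulr_sumr; apply: eq_bigr => w wY.
have := phi_tilde_genM iY wY; move: (tildeT C w) => T E.
by rewrite -scalerAr !phi_linearZ -scalerAr E.
Qed.

Lemma phiM (x y : H) : in_Hmu mu x -> in_Hmu mu y -> phi (x * y) = phi x * phi y.
Proof.
move=> /asboolP Hx; elim: Hx y => {x} [_ [i iY ->]|a|x z _ IHx _ IHz|x z xS IHx zS IHz] y yS.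
- exact: phi_genM.
- by rewrite -!scalerAl !linearZ /= phi1 -scalerAl mul1r Echi1_phi.
- by rewrite mulrDl !linearD /= mulrDl IHx // IHz.
- have zS' : in_Hmu mu z by apply/asboolP.
  have zyS : in_Hmu mu (z * y).
    by apply/asboolP; apply: subalg_mul => //; apply/asboolP.
  by rewrite -mulrA IHx // IHz // IHx // mulrA.
Qed.

Definition Zelt k : Y := tildeg C d (p k)^-1%g * Echi xi (chip k).

Lemma redwordV_reduced w : reduced (rev (redword w)).
Proof. by rewrite /reduced size_rev word_perm_rev redwordK size_redword ellV. Qed.

Lemma mul_Zelt x k :
  tildeg C d x * Zelt k = tildeg C d (pcomp x (p k)^-1%g) * Echi xi (chip k).
Proof.
rewrite /Zelt mulrA; have := moving_right xi x (moving_pV k).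
by rewrite tildeg_word ?redwordV_reduced // word_perm_rev redwordK.
Qed.

Lemma tildeg_pM k w : w \in Young mu ->
  tildeg C d (p k) * tildeg C d w * Echi1 = tildeg C d (pcomp (p k) w) * Echi1.
Proof.
move=> /YoungP wY; have := @moving_left _ _ _ xi (redword (p k)) w (chi1 mu).
by rewrite wY moving_p tildeg_word ?redword_reduced // redwordK; apply.
Qed.

Lemma tildeg_p_Echi1 k : tildeg C d (p k) * Echi1 = Echi xi (chip k) * tildeg C d (p k).
Proof. exact: tildeg_Echi. Qed.

Lemma Echi1_Zelt k : Echi1 * Zelt k = Zelt k.
Proof.
have E : Zelt k = Echi1 * tildeg C d (p k)^-1%g.
  by rewrite /Zelt tildeg_Echi chikV.
by rewrite E mulrA Echi1M.
Qed.

Lemma Zelt_Echi k : Zelt k * Echi xi (chip k) = Zelt k.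
Proof. by rewrite /Zelt -mulrA EchiM eqxx. Qed.

Lemma Zelt_p k l : Zelt k * (tildeg C d (p l) * Echi1) = if k == l then Echi1 else 0.
Proof.
rewrite tildeg_p_Echi1 /Zelt !mulrA -(mulrA _ (Echi _ _) (Echi _ _)) EchiM (inj_eq chik_inj).
case: eqP => [<-|_]; last by rewrite mulr0 mul0r.
rewrite -mulrA -tildeg_p_Echi1 mulrA.
have := moving_right xi (p k)^-1%g (moving_p k).
rewrite tildeg_word ?redword_reduced // redwordK => ->.
by rewrite /pcomp mulgV tildeg1 mul1r.
Qed.

(** The image of $\tilde T_w\mathrm M_{k,l}$ without its right idempotent, which is automatic since
    the permutation carries $\chi_l$ to $\chi_k$. *)
Definition Xelt k l w : Y :=
  Echi xi (chip k) * tildeg C d (pcomp (pcomp (p k) w) (p l)^-1%g).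

Lemma Xelt_act k l w : w \in Young mu ->
  char_act (pcomp (pcomp (p k) w) (p l)^-1%g) (chip l) = chip k.
Proof.
move=> /YoungP wY; rewrite /chik -char_actM pcompVK char_actM wY //.
Qed.

Lemma XeltE k l w : w \in Young mu -> Xelt k l w =
  tildeg C d (p k) * (tildeg C d w * Echi1) * Zelt l.
Proof.
move=> wY; rewrite /Xelt -{1}(Xelt_act k l wY) -tildeg_Echi -mul_Zelt.
by rewrite -{1}Echi1_Zelt mulrA -tildeg_pM // !mulrA.
Qed.

(** The factored form serves as the definition, so that row and column indices sit in separate
    factors and a product collapses through [Zelt_p]. The prescribed values are recovered in
    [Phi_specP]. *)
Definition Phi_val (M : MatH C mu) : Y :=
  \sum_k \sum_l tildeg C d (p k) * phi (hval (M k l)) * Zelt l.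

Lemma hval_sum (I : Type) (r : seq I) (F : I -> Hmu C mu) :
  hval (\sum_(k <- r) F k) = \sum_(k <- r) hval (F k).
Proof. exact: (raddf_sum (\val : Hmu C mu -> H)). Qed.

Lemma hvalZ a (x : Hmu C mu) : hval (a *: x) = a *: hval x.
Proof. by rewrite -[LHS]/(\val _) linearZ. Qed.

Lemma Phi_val_linear : linear Phi_val.
Proof.
move=> a M N; rewrite /Phi_val scaler_sumr -big_split; apply: eq_bigr => k _ /=.
rewrite scaler_sumr -big_split; apply: eq_bigr => l _ /=.
have -> : hval ((a *: M + N) k l) = a *: hval (M k l) + hval (N k l) by rewrite !mxE.
by rewrite linearP mulrDr mulrDl -scalerAr -scalerAl.
Qed.

Lemma Emu_Phi_val M : Emu xi mu * Phi_val M = Phi_val M.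
Proof.
rewrite mulr_sumr; apply: eq_bigr => k _; rewrite mulr_sumr; apply: eq_bigr => l _.
by rewrite -Echi1_phi (mulrA _ Echi1) tildeg_p_Echi1 -!mulrA mulrA Emu_Echi.
Qed.

(** The projection changes nothing, by [yval_Phi]; it only supplies membership in the corner. *)
Definition Phi (M : MatH C mu) : EY xi mu := projE xi mu (Phi_val M).

Lemma yval_Phi M : yval (Phi M) = Phi_val M.
Proof. exact: Emu_Phi_val. Qed.

Lemma Phi_linear : linear Phi.
Proof. by move=> a M N; apply: val_inj; rewrite /= Phi_val_linear mulrDr -scalerAr. Qed.

HB.instance Definition _ :=
  GRing.isLinear.Build A (MatH C mu) (EY xi mu) *:%R Phi Phi_linear.

Lemma Phi1 : Phi 1 = 1.
Proof.
apply: val_inj; rewrite [LHS]yval_Phi [RHS]/= Emu_chik; apply: eq_bigr => k _.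
rewrite (bigD1 k) //= big1 ?addr0 => [|l lk].
  rewrite !mxE eqxx phi1 -mulrA Echi1_Zelt mul_Zelt.
  by rewrite /pcomp mulVg tildeg1 mul1r.
by rewrite !mxE eq_sym (negPf lk) linear0 mulr0 mul0r.
Qed.

Lemma PhiM M N : Phi (M * N) = Phi M * Phi N.
Proof.
apply: val_inj; transitivity (yval (Phi M) * yval (Phi N)); last by [].
rewrite [LHS]yval_Phi !yval_Phi.
have E k l k' l' (x y : H) : tildeg C d (p k) * phi x * Zelt l *
    (tildeg C d (p k') * phi y * Zelt l') =
    if l == k' then tildeg C d (p k) * (phi x * phi y) * Zelt l' else 0.
  have := Zelt_p l k'; rewrite -{1}(Echi1_phi y); move: (Zelt l) (Zelt l') => z z' Ez.
  rewrite -!mulrA (mulrA _ Echi1) (mulrA z) Ez.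
  case: eqP => _; last by rewrite mul0r !mulr0.
  by rewrite (mulrA Echi1) Echi1_phi.
rewrite [RHS]mulr_suml; apply: eq_bigr => k _.
rewrite mulr_suml; transitivity (\sum_l \sum_l'
    tildeg C d (p k) * (phi (hval (M k l)) * phi (hval (N l l'))) * Zelt l').
  rewrite exchange_big /=; apply: eq_bigr => l' _.
  rewrite -mulr_suml -mulr_sumr; congr (_ * _ * _).
  rewrite mxE hval_sum phi_linear_sum; apply: eq_bigr => l _.
  by rewrite phiM //; [case: (M k l) | case: (N l l')].
apply: eq_bigr => l _; rewrite [RHS]mulr_sumr [RHS](bigD1 l) //= [X in _ + X]big1 ?addr0.
  by rewrite [RHS]mulr_sumr; apply: eq_bigr => l' _; rewrite E eqxx.
move=> k' k'l; rewrite [LHS]mulr_sumr big1 // => l' _.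
by rewrite E eq_sym (negPf k'l).
Qed.

Lemma elem_entry (M : MatH C mu) (x : H) k l k' l' : is_elem M x k l ->
  hval (M k' l') = if (k' == k) && (l' == l) then x else 0.
Proof.
move=> /matrixP /(_ k' l'); rewrite !mxE => ->.
by case: ifP => _; rewrite ?mulr1 ?mulr0.
Qed.

Lemma is_elem_uniq (M N : MatH C mu) (x : H) k l : is_elem M x k l -> is_elem N x k l -> M = N.
Proof.
move=> HM HN; apply/matrixP => k' l'; apply: val_inj.
by rewrite /= (elem_entry _ _ HM) (elem_entry _ _ HN).
Qed.

Lemma Phi_specP : Phi_spec p Phi.
Proof.
move=> w k l M wY HM; rewrite yval_Phi -/(Xelt k l w) XeltE // -mulrA Zelt_Echi.
rewrite /Phi_val (bigD1 k) //= (bigD1 l) //= (elem_entry _ _ HM) !eqxx phi_tildeT //.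
rewrite big1 ?addr0 => [|l' /negPf E].
  rewrite big1 ?addr0 // => k' /negPf E; rewrite big1 // => l' _.
  by rewrite (elem_entry _ _ HM) E linear0 mulr0 mul0r.
by rewrite (elem_entry _ _ HM) E andbF linear0 mulr0 mul0r.
Qed.

Definition elemM k l w : MatH C mu :=
  \matrix_(k', l') if (k' == k) && (l' == l) then HmuT C mu w else 0.

Lemma elemMP k l w : w \in Young mu -> is_elem (elemM k l w) (tildeT C w) k l.
Proof.
move=> wY; apply/matrixP => k' l'; rewrite !mxE.
by case: ifP => _; rewrite ?mulr1 ?mulr0 ?hval_HmuT.
Qed.

Lemma MatH_linear_ext (V : lmodType A) (f g : {linear MatH C mu -> V}) :
  (forall k l w, w \in Young mu -> f (elemM k l w) = g (elemM k l w)) -> f =1 g.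
Proof.
move=> fg M; have -> : M = \sum_k \sum_l \sum_(w in Young mu)
    coordH w (hval (M k l)) *: elemM k l w.
  apply/matrixP => k l.
  have sumE I (r : seq I) (P : pred I) (F : I -> MatH C mu) :
      (\sum_(i <- r | P i) F i) k l = \sum_(i <- r | P i) F i k l.
    exact: summxE.
  have ZE a (N : MatH C mu) : (a *: N) k l = a *: N k l by rewrite mxE.
  rewrite sumE (bigD1 k) //= [X in _ + X]big1 ?addr0; last first.
    move=> k' /negPf k'k; rewrite !sumE big1 // => l' _; rewrite sumE big1 // => w _.
    by rewrite ZE mxE eq_sym k'k scaler0.
  rewrite sumE (bigD1 l) //= [X in _ + X]big1 ?addr0; last first.
    move=> l' /negPf l'l; rewrite sumE big1 // => w _.
    by rewrite ZE mxE [l == _]eq_sym l'l andbF scaler0.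
  rewrite sumE; apply: val_inj => /=; rewrite -big_filter hval_sum big_filter.
  have kl : in_Hmu mu (hval (M k l)) by case: (M k l).
  rewrite [LHS](Hmu_span kl); apply: eq_bigr => w wY.
  by rewrite ZE mxE !eqxx /= hval_HmuT.
rewrite !linear_sum; apply: eq_bigr => k _; rewrite !linear_sum; apply: eq_bigr => l _.
rewrite !linear_sum; apply: eq_bigr => w wY.
by rewrite !linearZ /= fg.
Qed.

Hypothesis d_gt0 : (0 < d)%N.

(** As $w$ runs through $\mathfrak S^\mu$, the elements $\pi_kw\pi_l^{-1}$ are exactly the
    permutations carrying $\chi_l$ to $\chi_k$, so entry $(k,l)$ collects the coordinates that
    belong to it. *)
Definition Psi (y : EY xi mu) : MatH C mu := \matrix_(k, l) \sum_(w in Young mu)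
  coord xi (yval y) (chip k, pcomp (pcomp (p k) w) (p l)^-1%g) *: HmuT C mu w.

Lemma Psi_linear : linear Psi.
Proof.
move=> a y z; apply/matrixP => k l; rewrite !mxE scaler_sumr -big_split.
apply: eq_bigr => w _ /=.
by rewrite coord_linear scalerDl scalerA.
Qed.

HB.instance Definition _ :=
  GRing.isLinear.Build A (EY xi mu) (MatH C mu) *:%R Psi Psi_linear.

Lemma Psi_specP : Psi_spec p Psi.
Proof.
move=> w k l y Hw Ey; apply/matrixP => k' l'; rewrite !mxE.
rewrite -big_filter hval_sum big_filter Ey -/(ybasis xi (chip k, w)).
set w0 := pcomp _ (p l).
have w0Y : w0 \in Young mu.
  by apply/YoungP; rewrite !char_actM -/(chip l) Hw chikV.
have w0E : pcomp (pcomp (p k) w0) (p l)^-1%g = w.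
  by rewrite /w0 -!pcompA pcompVV /pcomp mulVg mul1g.
have [->|/negPf k'k] := eqVneq k' k; last first.
  rewrite andFb mulr0 big1 // => w' _.
  by rewrite hvalZ coord_ybasis // xpair_eqE (inj_eq chik_inj) k'k scale0r.
(* A nonzero coordinate in column [l'] would make [w] carry both $\chi_{l'}$ and $\chi_l$ to
   $\chi_k$. *)
have [->|/negPf l'l] := eqVneq l' l; last first.
  rewrite andbF mulr0 big1 // => w' w'Y; rewrite hvalZ coord_ybasis // xpair_eqE eqxx /=.
  case: eqP => [E|_]; last by rewrite scale0r.
  have := Xelt_act k l' w'Y; rewrite E -Hw => /(can_inj (char_actK w)) /chik_inj H.
  by rewrite H eqxx in l'l.
rewrite andbT mulr1 (bigD1 w0) // hvalZ w0E coord_ybasis // eqxx scale1r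
  big1 ?hval_HmuT // => [|w' /andP [w'Y /negPf w'w0]]; first by rewrite [LHS]addr0.
rewrite hvalZ coord_ybasis // xpair_eqE eqxx /=.
case: eqP => [E|_]; last by rewrite scale0r.
by rewrite /w0 -E -!pcompA pcompK /pcomp mulgV mul1g eqxx in w'w0.
Qed.

Lemma yval_proj k w : yval (projE xi mu (ybasis xi (chip k, w))) = Echi xi (chip k) * tildeg C d w.
Proof. by rewrite /= mulrA Emu_Echi. Qed.

Lemma EY_linear_ext (V : lmodType A) (f g : {linear EY xi mu -> V}) :
  (forall k w, f (projE xi mu (ybasis xi (chip k, w))) =
               g (projE xi mu (ybasis xi (chip k, w)))) -> f =1 g.
Proof.
(* Since $y=E_\mu y$, its expansion in the basis of the whole algebra may be projected termwise;
   labels whose character has another composition project to $0$. *)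
move=> fg y; have -> : y = \sum_q coord xi (yval y) q *: projE xi mu (ybasis xi q).
  apply: val_inj; rewrite raddf_sum /=.
  rewrite -[LHS]evalK {1}(coordE xi d_gt0 (yval y)) mulr_sumr.
  by apply: eq_bigr => q _; rewrite -scalerAr.
rewrite !linear_sum; apply: eq_bigr => -[chi w] _; rewrite !linearZ /=; congr (_ *: _).
have [/chik_onto [k <-] //|Hchi] := boolP (has_comp mu chi).
have -> : projE xi mu (ybasis xi (chi, w)) = 0; last by rewrite !linear0.
apply: val_inj; rewrite /= mulrA /Emu mulr_suml big1 ?mul0r // => psi Hpsi.
by rewrite EchiM; case: eqP Hpsi Hchi => // -> ->.
Qed.

Lemma PhiK : cancel Phi Psi.
Proof.
move=> M; apply: (MatH_linear_ext (f := Psi \o Phi) (g := idfun)) => k l w wY /=.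
have HM := elemMP k l wY.
suff HP : is_elem (Psi (Phi (elemM k l w))) (tildeT C w) k l.
  exact: (is_elem_uniq HP HM).
set w1 := pcomp (pcomp (p k) w) (p l)^-1%g.
have E : pcomp (pcomp (p k)^-1%g w1) (p l) = w.
  by rewrite -!pcompA pcompK /pcomp mulgV mul1g.
rewrite -[X in is_elem _ (tildeT C X)]E; apply: Psi_specP (Xelt_act k l wY) _.
by rewrite (Phi_specP wY HM) -mulrA tildeg_Echi Xelt_act // mulrA EchiM eqxx.
Qed.

Lemma PsiK : cancel Psi Phi.
Proof.
move=> y; apply: (EY_linear_ext (f := Phi \o Psi) (g := idfun)) => k w /=.
have [l Hw] := chik_act k w.
have HM := Psi_specP Hw (yval_proj k w).
apply: val_inj; rewrite -[LHS]/(yval _) (Phi_specP _ HM); last first.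
  by apply/YoungP; rewrite !char_actM -/(chip l) Hw chikV.
rewrite -[RHS]/(yval _) yval_proj -!pcompA pcompVV.
have -> : pcomp w (pcomp (p l) (p l)^-1%g) = w by rewrite /pcomp mulVg mul1g.
by rewrite -mulrA tildeg_Echi Hw mulrA EchiM eqxx.
Qed.

(** Because the $\tilde T_w\mathrm M_{k,l}$ span, this identifies [Phi] as the map meant in the
    theorem and not merely as some isomorphism. *)
Lemma Phi_spec_uniq (f : {linear MatH C mu -> EY xi mu}) : Phi_spec p f <-> f =1 Phi.
Proof.
split=> [Hf|E]; last by move=> w k l M wY HM; rewrite E; apply: Phi_specP.
apply: MatH_linear_ext => k l w wY; apply: val_inj; have HM := elemMP k l wY.
by rewrite -[LHS]/(yval _) (Hf _ _ _ _ wY HM) -[RHS]/(yval _) (Phi_specP wY HM).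
Qed.

Lemma Psi_spec_uniq (f : {linear EY xi mu -> MatH C mu}) : Psi_spec p f <-> f =1 Psi.
Proof.
split=> [Hf|E]; last by move=> w k l y Hw Ey; rewrite E; apply: Psi_specP.
apply: EY_linear_ext => k w.
have [l Hw] := chik_act k w.
exact: (is_elem_uniq (Hf _ _ _ _ Hw (yval_proj k w)) (Psi_specP Hw (yval_proj k w))).
Qed.

End Isomorphism.

(** * Assembling the components over all compositions *)

Section Decomposition.
Context (C : numFieldType) (d n : nat) (xi : unity_roots C d).
Hypothesis d_gt0 : (0 < d)%N.
Local Notation Y := (yokonuma C d n).
Implicit Types (mu nu : Comp d n).

Lemma has_comp_uniq mu nu (chi : tchar d n) : has_comp mu chi -> has_comp nu chi -> mu = nu.
Proof.
move=> /forallP Hmu /forallP Hnu; apply/val_inj/ffunP => a; apply: val_inj.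
by have := Hmu a; rewrite (eqP (Hnu a)) => /eqP.
Qed.

Lemma has_comp_ex (chi : tchar d n) : exists mu, has_comp mu chi.
Proof.
have le a : (#|[set j | chi j == a]| < n.+1)%N.
  by rewrite ltnS -[X in (_ <= X)%N]card_ord max_card.
pose f := [ffun a => Ordinal (le a)].
have f_sum : (\sum_a (f a : nat) == n)%N.
  rewrite -[X in _ == X]card_ord -sum1_card (partition_big chi predT) //=; apply/eqP.
  by apply: eq_bigr => a _; rewrite ffunE /= sum1_card; apply: eq_card => j; rewrite inE.
by exists (exist _ f f_sum : Comp d n); apply/forallP => a; rewrite /part /= ffunE.
Qed.

(** Every character has exactly one composition, so the $E_\mu$ regroup the resolution $\sum_\chi
    E_\chi=1$. *)
Lemma Emu_sum : \sum_mu Emu xi mu = 1 :> Y.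
Proof.
rewrite -(Echi_sum n xi d_gt0) /Emu (exchange_big_dep predT) //=; apply: eq_bigr => chi _.
have [mu Hmu] := has_comp_ex chi.
rewrite (bigD1 mu) //= big1 ?addr0 // => nu /andP [Hnu].
by rewrite (has_comp_uniq Hnu Hmu) eqxx.
Qed.

Lemma Emu_orth mu nu : mu != nu -> Emu xi mu * Emu xi nu = 0.
Proof.
move=> ne; rewrite {1}/Emu mulr_suml big1 // => chi Hchi.
rewrite /Emu mulr_sumr big1 // => psi Hpsi; rewrite EchiM.
by case: eqP => // E; rewrite -E in Hpsi; rewrite (has_comp_uniq Hchi Hpsi) eqxx in ne.
Qed.

Lemma Emu_yval mu nu (y : EY xi nu) : mu != nu -> Emu xi mu * yval y = 0.
Proof. by move=> ne; rewrite -evalK mulrA Emu_orth // mul0r. Qed.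

Lemma yvalM_orth mu nu (y : EY xi mu) (z : EY xi nu) : mu != nu -> yval y * yval z = 0.
Proof. by move=> ne; rewrite -(evalK y) Emu_comm -mulrA Emu_yval // mulr0. Qed.

Context (Phi : forall mu, {linear MatH C mu -> EY xi mu}).
Context (Psi : forall mu, {linear EY xi mu -> MatH C mu}).

Lemma Phi_sum_linear : linear (Phi_sum Phi).
Proof.
move=> a x y; rewrite /Phi_sum scaler_sumr -big_split; apply: eq_bigr => mu _ /=.
have -> : (a *: x + y) mu = a *: x mu + y mu by rewrite !ffunE.
by rewrite linearP.
Qed.

Lemma projE_Phi_sum mu (x : DirSum C d n) : projE xi mu (Phi_sum Phi x) = Phi mu (x mu).
Proof.
apply: val_inj; rewrite /= /Phi_sum mulr_sumr (bigD1 mu) //= big1 ?addr0 ?evalK //.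
by move=> nu nemu; rewrite Emu_yval // eq_sym.
Qed.

Lemma Phi_sumK : (forall mu, cancel (Phi mu) (Psi mu)) -> cancel (Phi_sum Phi) (Psi_sum Psi).
Proof. by move=> H x; apply/ffunP => mu; rewrite ffunE projE_Phi_sum H. Qed.

Lemma Psi_sumK : (forall mu, cancel (Psi mu) (Phi mu)) -> cancel (Psi_sum Psi) (Phi_sum Phi).
Proof.
move=> H y; rewrite -[RHS]mul1r -Emu_sum mulr_suml; apply: eq_bigr => mu _.
by rewrite ffunE H.
Qed.

Lemma Phi_sum_morphism : (forall mu, monoid_morphism (Phi mu)) -> monoid_morphism (Phi_sum Phi).
Proof.
move=> H; split.
  rewrite -Emu_sum; apply: eq_bigr => mu _.
  have -> : (1 : DirSum C d n) mu = 1 by rewrite ffunE.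
  by rewrite (H mu).1.
move=> x y; rewrite /Phi_sum mulr_suml; apply: eq_bigr => mu _.
rewrite mulr_sumr (bigD1 mu) //= big1 ?addr0 => [|nu nemu].
  have -> : (x * y) mu = x mu * y mu by rewrite ffunE.
  by rewrite (H mu).2.
by rewrite yvalM_orth // eq_sym.
Qed.

End Decomposition.

Theorem theorem3p1 (R : realType) (d n : nat) (d_ge1 : (1 <= d)%N) (n_ge1 : (1 <= n)%N)
    (xi : unity_roots R[i] d)
    (p : forall mu : Comp d n, 'I_(multinom mu) -> 'S_n)
    (p_lab : forall mu : Comp d n, labelling (p mu)) :
  exists (Phi : forall mu : Comp d n, {linear MatH R[i] mu -> EY xi mu})
         (Psi : forall mu : Comp d n, {linear EY xi mu -> MatH R[i] mu}),
  [/\ forall mu : Comp d n,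
        (forall f : {linear MatH R[i] mu -> EY xi mu},
           Phi_spec (p mu) f <-> f =1 Phi mu) /\
        (forall f : {linear EY xi mu -> MatH R[i] mu},
           Psi_spec (p mu) f <-> f =1 Psi mu),
      forall mu : Comp d n,
        [/\ monoid_morphism (Phi mu),
            cancel (Phi mu) (Psi mu) & cancel (Psi mu) (Phi mu)]
    & [/\ linear (Phi_sum Phi), monoid_morphism (Phi_sum Phi),
          cancel (Phi_sum Phi) (Psi_sum Psi) & cancel (Psi_sum Psi) (Phi_sum Phi)]].
Proof.
pose F mu : {linear MatH R[i] mu -> EY xi mu} := Phi xi (p mu).
pose G mu : {linear EY xi mu -> MatH R[i] mu} := Psi (p mu).
have FM mu : monoid_morphism (F mu).
  by split=> [|M N]; [apply: Phi1 | apply: PhiM].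
have FK mu : cancel (F mu) (G mu) by apply: PhiK.
have GK mu : cancel (G mu) (F mu) by apply: PsiK.
exists F, G; split.
- by move=> mu; split=> f; [apply: Phi_spec_uniq | apply: Psi_spec_uniq].
- by move=> mu; split.
- split; [exact: Phi_sum_linear | exact: Phi_sum_morphism | exact: Phi_sumK | exact: Psi_sumK].
Qed.
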